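(* Let $X$ be a real Banach lattice which is a dual Banach space, $X=Y^*$ for some fixed Banach space $Y$. Let $\mathcal C$ be a convex collection of positive adjoint operators on $X$. If there is $x_0>0$ in $X$ such that every operator from $\mathcal C$ is locally quasinilpotent at $x_0$, then there exist non-zero $x\in X_+$ and non-zero $f\in X^*_+$ such that $\langle f,Tx\rangle\le\lVert T_*\rVert_e$ for all $T\in\mathcal C$.
   Context: $L(Z)$ denotes the space of bounded linear operators on a Banach space $Z$. $X_+$ and $X^*_+$ denote the cones of positive elements of $X$ and $X^*$; $x_0>0$ means $x_0\in X_+$ and $x_0\neq 0$. An operator $T\in L(X)$ is positive if $T(X_+)\subseteq X_+$. An operator $T\in L(X)$ is called adjoint (with respect to the fixed predual $Y$) if $T=S^*$ for some $S\in L(Y)$; this $S$ is unique and is denoted $T_*$. For an operator $S\in L(Y)$, $\lVert S\rVert_e$ is the essential norm, i.e. the distance in operator norm from $S$ to the space of compact operators on $Y$. An operator $T$ is locally quasinilpotent at $x$ if $\limsup_n\lVert T^nx\rVert^{1/n}=0$. *)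

(* Defs.v *)
From HB Require Import structures.
From mathcomp Require Import all_boot all_order all_algebra.
From mathcomp Require Import all_classical all_reals all_analysis.

Set Implicit Arguments.
Unset Strict Implicit.
Unset Printing Implicit Defensive.

Import Order.TTheory GRing.Theory Num.Theory.
Import numFieldNormedType.Exports.

Local Open Scope classical_set_scope.
Local Open Scope ring_scope.

(* The order is a field of the mixin because the order
   structures of MathComp have no join with the normed modules. Binary suprema
   suffice for a lattice: - vjoin (- x) (- y) is the infimum of x and y.
   The modulus of x is [vjoin x (- x)], whereas [`|x|] is always the norm. *)
HB.mixin Record isBanachLattice (R : realType) X & CompleteNormedModule R X := {
  vle : rel X ;
  vlexx : reflexive vle ;
  vle_anti : antisymmetric vle ;
  vle_trans : transitive vle ;
  vleD2r : forall z x y, vle x y -> vle (x + z) (y + z) ;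
  vscale_ge0 : forall (a : R) x, 0 <= a -> vle 0 x -> vle 0 (a *: x) ;
  vjoin : X -> X -> X ;
  vjoin_le : forall x y z, vle (vjoin x y) z = vle x z && vle y z ;
  vnorm_le : forall x y, vle (vjoin x (- x)) (vjoin y (- y)) -> `|x| <= `|y| }.

#[short(type="banachLatticeType")]
HB.structure Definition BanachLattice (R : realType) :=
  {X of CompleteNormedModule R X & isBanachLattice R X}.

Notation "x <=v y" := (vle x y) (at level 70, y at next level) : ring_scope.

Section operators.
Context {R : realType}.

Definition bounded_op {V W : normedModType R} (T : V -> W) : Prop :=
  linear T /\ continuous T.

(* This is the operator norm only when [T] is bounded: [sup] of a set that is
   not bounded above has a junk value. *)
Definition opnorm {V W : normedModType R} (T : V -> W) : R :=
  sup [set `|T x| | x in [set x | `|x| <= 1]].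

Definition compact_op {V W : normedModType R} (K : V -> W) : Prop :=
  bounded_op K /\ precompact (K @` [set x | `|x| <= 1]).

Definition essnorm {V : normedModType R} (S : V -> V) : R :=
  inf [set opnorm (S \- K) | K in [set K : V -> V | compact_op K]].

Definition locally_quasinilpotent {V : normedModType R} (T : V -> V) (x : V) :
    Prop :=
  limn_esup (fun n => (`|iter n T x| `^ n%:R^-1)%:E) = 0%E.

Definition positive_op {X : banachLatticeType R} (T : X -> X) : Prop :=
  forall x, 0 <=v x -> 0 <=v T x.

Definition positive_functional {X : banachLatticeType R} (f : X -> R) : Prop :=
  forall x, 0 <=v x -> 0 <= f x.

(* [J] is a linear isometry of [X] onto the dual space of [Y]; it realizes the
   identification of [X] with Y^*, and [J x y] is the pairing of [y] with [x]. *)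
Definition dual_identification {X Y : normedModType R} (J : X -> Y -> R) :
    Prop :=
  [/\ linear J,
      forall x, bounded_op (J x),
      forall x, opnorm (J x) = `|x|
    & forall g : Y -> R, bounded_op g -> exists x, J x = g].

Definition adjoint_of {X Y : normedModType R} (J : X -> Y -> R)
    (T : X -> X) (S : Y -> Y) : Prop :=
  bounded_op S /\ forall x y, J (T x) y = J x (S y).

Definition is_adjoint {X Y : normedModType R} (J : X -> Y -> R)
    (T : X -> X) : Prop :=
  exists S, adjoint_of J T S.

(* The unique [S] of which [T] is the adjoint; zero if [T] is not an adjoint
   operator. *)
Definition preadjoint {X Y : normedModType R} (J : X -> Y -> R)
    (T : X -> X) : Y -> Y :=
  xget (fun=> 0) [set S | adjoint_of J T S].

End operators.

(* Main.v *)
Require Import Defs.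
From mathcomp Require Import all_boot all_order all_algebra.
From mathcomp Require Import all_classical all_reals all_analysis.
From mathcomp Require Import ring lra.

Import Order.TTheory GRing.Theory Num.Theory.
Import numFieldNormedType.Exports.

Local Open Scope classical_set_scope.
Local Open Scope ring_scope.

(** Suppose that no [x] and [f] exist. For a positive non-zero [x], consider on
    [X] the sublinear functional whose value at [y] is the least cost
    [c + |(y - S x)^+|] of lifting [x] above [y] by an operator [S] of the cone
    generated by [C], where [c] measures how far [S] is from being weak-star to
    norm continuous on bounded sets. If it is positive at some [e], the
    Hahn-Banach theorem gives a positive functional [f <> 0] below it. Then
    [f (T x) <= c] for [T] in [C], and [c] can be the norm of [T_* - K] for any
    compact [K], because adjoints of compact operators are weak-star to norm
    continuous on bounded sets ([separating_functional]). So this functional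
    vanishes at [e]: every positive non-zero [x] is lifted almost above [e] by
    operators that are almost weak-star to norm continuous.

    Apply this to the vectors [x] of [[0, e]] close to a fixed non-zero
    [e <= x0]. Weak-star compactness replaces the operators, which depend on
    [x], by a single [S = t T] of the cone ([uniform_push]). The sequence
    [z_0 = e], [z_(n+1) = e /\ S z_n] stays close to [e], and [z_n <= S^n x0], so
    that the norms [|t^n T^n x0|] are bounded away from zero; this contradicts
    the local quasinilpotence of [T] at [x0].

    The compactness argument needs weak-star limits of elements of [[0, e]] to
    lie in [[0, e]], but no compatibility of the order with the predual is
    assumed. It is proved for a suitable [e] ([interval_wstar_closed]) in three
    stages.

    - Order bounded directed sets have suprema, on which the functionals of the
      predual are continuous ([directed_sup]). A weak-star cluster point [s] of
      an increasing net is its supremum, because the norm is weak-star lower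
      semicontinuous and [|u + |c||] is the supremum of the [|v + c|] with
      [|v| <= u] ([norm_add_abs_le]).

    - Consequently the positive part [psi] of a functional of the predual is
      order continuous, and there is a non-zero [e] in [[0, x0]] below which
      some [psi] is strictly positive ([strictly_positive_part]).

    - On [[0, e]] the seminorm [psi |z|] is then a substitute for the norm of
      [L^1]. Let [x] be a weak-star limit of elements of [[0, e]]. A uniformly
      convex energy selects, in each weak-star neighbourhood of [x], elements of
      [[0, e]] that form a Cauchy sequence for [psi |z|] ([admissible_shrink]);
      such sequences converge in order ([order_limit]), and order convergence
      implies weak-star convergence, so the limit is [x]. *)

Set Implicit Arguments.
Unset Strict Implicit.
Unset Printing Implicit Defensive.

(** * Linear identities in modules *)

Section module_identities.
Context {R : realType} {V : lmodType R}.

(** Formal combinations of the atoms of an environment, for proofs by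
    reflection. *)
Inductive vexp :=
  | VVar of nat
  | VZero
  | VAdd of vexp & vexp
  | VOpp of vexp
  | VScale of R & vexp.

Fixpoint veval (env : seq V) (e : vexp) : V :=
  match e with
  | VVar n => nth 0 env n
  | VZero => 0
  | VAdd a b => veval env a + veval env b
  | VOpp a => - veval env a
  | VScale r a => r *: veval env a
  end.

Fixpoint vcoef (i : nat) (e : vexp) : R :=
  match e with
  | VVar n => if Nat.eqb i n then 1 else 0
  | VZero => 0
  | VAdd a b => vcoef i a + vcoef i b
  | VOpp a => - vcoef i a
  | VScale r a => r * vcoef i a
  end.

Fixpoint same_coefs (n : nat) (e1 e2 : vexp) : Prop :=
  match n with
  | O => True
  | S k => vcoef k e1 = vcoef k e2 /\ same_coefs k e1 e2
  end.

Lemma veval_coef env e :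
  veval env e = \sum_(i < size env) vcoef i e *: nth 0 env i.
Proof.
elim: e => [n||a IHa b IHb|a IHa|r a IHa] /=.
- have eqbE i : (if Nat.eqb i n then 1 else 0 : R) = (i == n)%:R.
    suff -> : Nat.eqb i n = (i == n) by case: (i == n).
    by elim: i n => [|i IHi] [|n] //=; rewrite IHi.
  under eq_bigr do rewrite eqbE.
  case: (ltnP n (size env)) => [ltn|gen].
    rewrite (bigD1 (Ordinal ltn)) //= eqxx scale1r big1 ?addr0 // => i /eqP ni.
    by case: eqP => [e|_]; [case: ni; exact/val_inj|rewrite scale0r].
  rewrite nth_default // big1 // => i _.
  by rewrite (ltn_eqF (leq_trans (ltn_ord i) gen)) scale0r.
- by rewrite big1 // => i _; rewrite scale0r.
- by rewrite IHa IHb -big_split; apply: eq_bigr => i _; rewrite /= scalerDl.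
- by rewrite IHa -sumrN; apply: eq_bigr => i _; rewrite scaleNr.
- by rewrite IHa scaler_sumr; apply: eq_bigr => i _; rewrite scalerA.
Qed.

Lemma veval_eq env e1 e2 :
  same_coefs (size env) e1 e2 -> veval env e1 = veval env e2.
Proof.
have same_coef n i : same_coefs n e1 e2 -> (i < n)%N -> vcoef i e1 = vcoef i e2.
  elim: n => [//|n IHn] /= [h1 h2].
  by rewrite ltnS leq_eqVlt => /orP[/eqP->//|]; exact: IHn.
move=> h; rewrite !veval_coef; apply: eq_bigr => i _; congr (_ *: _).
exact: same_coef h _.
Qed.

End module_identities.

(** Syntactic equality is tried first because unification of distinct atoms can
    unfold the algebraic structures; it is needed for atoms that differ in the
    path of an inferred structure only. *)
Ltac vsame x y :=
  match constr:(Set) with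
  | _ => let _ := match constr:(Set) with _ => constr_eq x y end in constr:(true)
  | _ => let _ := match constr:(Set) with _ => unify x y end in constr:(true)
  | _ => constr:(false)
  end.

Ltac vmem x l :=
  lazymatch l with
  | nil => constr:(false)
  | cons ?y ?l' =>
    let b := vsame x y in
    lazymatch b with true => constr:(true) | false => vmem x l' end
  end.

Ltac vatoms t l :=
  lazymatch t with
  | (?a + ?b)%R => let l1 := vatoms a l in vatoms b l1
  | (- ?a)%R => vatoms a l
  | (?r *: ?a)%R => vatoms a l
  | 0%R => l
  | _ => let m := vmem t l in
         lazymatch m with true => l | false => constr:(cons t l) end
  end.

Ltac vindex x l :=
  lazymatch l with
  | cons ?y ?l' =>
    let b := vsame x y in
    lazymatch b with
    | true => constr:(O)
    | false => let k := vindex x l' in constr:(S k)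
    end
  end.

Ltac vreify R t l :=
  lazymatch t with
  | (?a + ?b)%R =>
    let x := vreify R a l in let y := vreify R b l in constr:(@VAdd R x y)
  | (- ?a)%R => let x := vreify R a l in constr:(@VOpp R x)
  | (?r *: ?a)%R => let x := vreify R a l in constr:(@VScale R r x)
  | 0%R => constr:(@VZero R)
  | _ => let k := vindex t l in constr:(@VVar R k)
  end.

(** Linear identities in a module over the reals, by comparison of the
    coefficients of the atoms. *)
Ltac vmod :=
  lazymatch goal with
  | R : realType |- @eq ?V ?s ?t =>
    let l0 := constr:(@nil V) in
    let l1 := vatoms s l0 in
    let l := vatoms t l1 in
    let e1 := vreify R s l in
    let e2 := vreify R t l in
    refine (@veval_eq R _ l e1 e2 _);
    cbv [vcoef same_coefs Nat.eqb size]; repeat (apply: conj); first [exact: I | ring | lra | by field]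
  end.

(** * Vector lattices *)

Section vector_lattice.
Context {R : realType} {X : banachLatticeType R}.
Implicit Types (x y z a b c d u v w e : X) (t : R).

Definition vmeet x y : X := - vjoin (- x) (- y).
Definition vpos x : X := vjoin x 0.
Definition vabs x : X := vjoin x (- x).

Lemma vle_refl x : x <=v x. Proof. exact: vlexx. Qed.

Lemma vle_tr x y z : x <=v y -> y <=v z -> x <=v z.
Proof. exact: vle_trans. Qed.

Lemma vle_asym x y : x <=v y -> y <=v x -> x = y.
Proof. by move=> h1 h2; apply: vle_anti; rewrite h1 h2. Qed.

Lemma vsub_ge0 x y : (0 <=v y - x) = (x <=v y).
Proof.
apply/idP/idP => [/(vleD2r x)|/(vleD2r (- x))]; first by rewrite add0r subrK.
by rewrite subrr.
Qed.

Lemma vaddr_ge0 x y : 0 <=v x -> 0 <=v y -> 0 <=v x + y.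
Proof. by move=> hx /(vleD2r x); rewrite add0r addrC; exact: vle_tr. Qed.

(** This lemma and the next two reduce an inequality to the remark that [y - x]
    is a sum of differences known to be positive. *)
Lemma vle_of1 a b x y : a <=v b -> y - x = b - a -> x <=v y.
Proof. by rewrite -(vsub_ge0 a) -(vsub_ge0 x) => ? ->. Qed.

Lemma vle_of2 a b c d x y :
  a <=v b -> c <=v d -> y - x = (b - a) + (d - c) -> x <=v y.
Proof. by rewrite -(vsub_ge0 a) -(vsub_ge0 c) -(vsub_ge0 x) => ? ? ->; exact: vaddr_ge0. Qed.

Lemma vle_of3 a b c d u v x y : a <=v b -> c <=v d -> u <=v v ->
  y - x = (b - a) + (d - c) + (v - u) -> x <=v y.
Proof.
rewrite -(vsub_ge0 a) -(vsub_ge0 c) -(vsub_ge0 u) -(vsub_ge0 x) => h1 h2 h3 ->.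
exact: vaddr_ge0 (vaddr_ge0 h1 h2) h3.
Qed.

Lemma vleZ t x y : 0 <= t -> x <=v y -> t *: x <=v t *: y.
Proof.
by move=> t0; rewrite -(vsub_ge0 x) -(vsub_ge0 (t *: x)) -scalerBr; exact: vscale_ge0.
Qed.

Lemma vleN x y : (- x <=v - y) = (y <=v x).
Proof. by apply/idP/idP => h; apply: (vle_of1 h); vmod. Qed.

Lemma vleD x y z w : x <=v y -> z <=v w -> x + z <=v y + w.
Proof. by move=> h1 h2; apply: (vle_of2 h1 h2); vmod. Qed.

Lemma vjoin_l x y : x <=v vjoin x y.
Proof. by have := vle_refl (vjoin x y); rewrite vjoin_le => /andP[]. Qed.

Lemma vjoin_r x y : y <=v vjoin x y.
Proof. by have := vle_refl (vjoin x y); rewrite vjoin_le => /andP[]. Qed.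

Lemma vjoin_lub x y z : x <=v z -> y <=v z -> vjoin x y <=v z.
Proof. by rewrite vjoin_le => -> ->. Qed.

Lemma vmeet_l x y : vmeet x y <=v x.
Proof. by rewrite -vleN opprK; exact: vjoin_l. Qed.

Lemma vmeet_r x y : vmeet x y <=v y.
Proof. by rewrite -vleN opprK; exact: vjoin_r. Qed.

Lemma vmeet_glb x y z : z <=v x -> z <=v y -> z <=v vmeet x y.
Proof. by move=> h1 h2; rewrite -vleN opprK; apply: vjoin_lub; rewrite vleN. Qed.

Lemma vjoinC x y : vjoin x y = vjoin y x.
Proof.
by apply: vle_asym; apply: vjoin_lub; rewrite ?vjoin_l ?vjoin_r.
Qed.

Lemma vmeetC x y : vmeet x y = vmeet y x.
Proof. by rewrite /vmeet vjoinC. Qed.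

Lemma vjoinDr x y z : vjoin x y + z = vjoin (x + z) (y + z).
Proof.
apply: vle_asym; last by apply: vjoin_lub; apply: vleD2r; rewrite ?vjoin_l ?vjoin_r.
have h : vjoin x y <=v vjoin (x + z) (y + z) - z.
  apply: vjoin_lub; [apply: (vle_of1 (vjoin_l (x + z) (y + z)))
                    |apply: (vle_of1 (vjoin_r (x + z) (y + z)))]; vmod.
by apply: (vle_of1 h); vmod.
Qed.

Lemma vmeetDr x y z : vmeet x y + z = vmeet (x + z) (y + z).
Proof. by rewrite /vmeet !opprD -vjoinDr; vmod. Qed.

Lemma vjoin_meet x y : vjoin x y + vmeet x y = x + y.
Proof.
have -> : vjoin x y = vjoin (- x) (- y) + (x + y).
  by rewrite vjoinDr vjoinC; congr vjoin; vmod.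
by rewrite /vmeet; vmod.
Qed.

Lemma vjoinZ t x y : 0 < t -> t *: vjoin x y = vjoin (t *: x) (t *: y).
Proof.
move=> t0; apply: vle_asym; last first.
  by apply: vjoin_lub; apply: vleZ; rewrite ?ltW ?vjoin_l ?vjoin_r.
have h : vjoin x y <=v t^-1 *: vjoin (t *: x) (t *: y).
  apply: vjoin_lub; rewrite -[X in X <=v _](scalerK (lt0r_neq0 t0));
  by apply: vleZ; rewrite ?invr_ge0 ?ltW ?vjoin_l ?vjoin_r.
by have := vleZ (ltW t0) h; rewrite scalerA divff ?lt0r_neq0 // scale1r.
Qed.

Lemma vpos_ge0 x : 0 <=v vpos x. Proof. exact: vjoin_r. Qed.
Lemma vpos_ge x : x <=v vpos x. Proof. exact: vjoin_l. Qed.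
Lemma vpos_lub x y : x <=v y -> 0 <=v y -> vpos x <=v y.
Proof. exact: vjoin_lub. Qed.

Lemma vpos_mono x y : x <=v y -> vpos x <=v vpos y.
Proof. by move=> h; apply: vpos_lub (vpos_ge0 _); exact: vle_tr h (vpos_ge _). Qed.

Lemma vpos_id x : 0 <=v x -> vpos x = x.
Proof. by move=> h; apply: vle_asym (vpos_ge x); exact: vpos_lub (vle_refl _) h. Qed.

Lemma vpos_eq0 x : x <=v 0 -> vpos x = 0.
Proof. by move=> h; apply: vle_asym (vpos_ge0 x); exact: vpos_lub h (vle_refl _). Qed.

Lemma vpos0 : vpos (0 : X) = 0. Proof. exact/vpos_eq0/vle_refl. Qed.

Lemma vposB x : vpos x - vpos (- x) = x.
Proof.
have -> : vpos (- x) = vpos x - x by rewrite /vpos vjoinDr vjoinC; congr vjoin; vmod.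
by vmod.
Qed.

Lemma vposZ t x : 0 <= t -> vpos (t *: x) = t *: vpos x.
Proof.
rewrite le_eqVlt => /orP[/eqP<-|t0]; first by rewrite !scale0r vpos0.
by rewrite /vpos vjoinZ // scaler0.
Qed.

Lemma vposD x y : vpos (x + y) <=v vpos x + vpos y.
Proof. by apply: vpos_lub (vaddr_ge0 (vpos_ge0 _) (vpos_ge0 _)); apply: vleD; exact: vpos_ge. Qed.

Lemma vmeet_pos_neg x : vmeet (vpos x) (vpos (- x)) = 0.
Proof.
have -> : vpos x = x + vpos (- x) by rewrite -{2}(vposB x); vmod.
have -> : vmeet (x + vpos (- x)) (vpos (- x)) = vmeet x 0 + vpos (- x).
  by rewrite vmeetDr add0r.
by rewrite /vmeet /vpos oppr0; vmod.
Qed.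

Lemma vsub_meet x y : x - vmeet x y = vpos (x - y).
Proof.
have -> : vpos (x - y) = vjoin x y - y by rewrite vjoinDr subrr.
have -> : vjoin x y = x + y - vmeet x y by rewrite -(vjoin_meet x y); vmod.
by vmod.
Qed.

Lemma vmeet_ge0 x y : 0 <=v x -> 0 <=v y -> 0 <=v vmeet x y.
Proof. exact: vmeet_glb. Qed.

Lemma vmeet_idl x y : x <=v y -> vmeet x y = x.
Proof.
by move=> h; apply: vle_asym (vmeet_l x y) _; exact: vmeet_glb (vle_refl _) h.
Qed.

Lemma vmeet_mono x y z w : x <=v y -> z <=v w -> vmeet x z <=v vmeet y w.
Proof.
move=> h1 h2; apply: vmeet_glb; first exact: vle_tr (vmeet_l _ _) h1.
exact: vle_tr (vmeet_r _ _) h2.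
Qed.

Lemma vmeet_addl x y z : 0 <=v x -> 0 <=v y -> 0 <=v z ->
  vmeet (x + y) z <=v vmeet x z + vmeet y z.
Proof.
move=> x0 y0 z0; set m := vmeet (x + y) z.
suff h : m - vmeet x z <=v vmeet y z by apply: (vle_of1 h); vmod.
apply: vmeet_glb.
  have h : m <=v vmeet (x + y) (z + y).
    apply: vmeet_mono (vle_refl _) _; apply: (vle_of1 y0); vmod.
  by rewrite -vmeetDr in h; apply: (vle_of1 h); vmod.
apply: (vle_of2 (vmeet_ge0 x0 z0) (vmeet_r (x + y) z)); rewrite -/m; vmod.
Qed.

Lemma vmeet_add x y z w :
  vmeet x z + vmeet y w <=v vmeet (x + y) (z + w).
Proof. by apply: vmeet_glb; apply: vleD; rewrite ?vmeet_l ?vmeet_r. Qed.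

(** The part of [z] in [y + z] does not help an [x] that is disjoint from it. *)
Lemma vle_disjoint x y z : 0 <=v x -> 0 <=v y -> 0 <=v z ->
  vmeet x z = 0 -> x <=v y + z -> x <=v y.
Proof.
move=> x0 y0 z0 xz xyz.
have : x <=v vmeet (y + z) x by apply: vmeet_glb (vle_refl _).
move=> /vle_tr; apply; apply: (vle_tr (vmeet_addl y0 z0 x0)).
by rewrite (vmeetC z) xz addr0; exact: vmeet_l.
Qed.

Lemma vabs_pos x : vabs x = 2 *: vpos x - x.
Proof.
have -> : 2 *: vpos x = vabs x + x.
  by rewrite /vabs vjoinDr /vpos vjoinZ ?ltr0n // scaler0; congr vjoin; vmod.
by vmod.
Qed.

Lemma vabsE x : vabs x = vpos x + vpos (- x).
Proof.
rewrite vabs_pos -[X in _ - X]vposB; vmod.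
Qed.

Lemma vabs_ge0 x : 0 <=v vabs x.
Proof. by rewrite vabsE vaddr_ge0 ?vpos_ge0. Qed.

Lemma vabs_ge x : x <=v vabs x. Proof. exact: vjoin_l. Qed.

Lemma vabsN x : vabs (- x) = vabs x.
Proof. by rewrite /vabs opprK vjoinC. Qed.

Lemma vabs_geN x : - x <=v vabs x. Proof. exact: vjoin_r. Qed.

Lemma vabs_lub x y : x <=v y -> - x <=v y -> vabs x <=v y.
Proof. exact: vjoin_lub. Qed.

Lemma vabs_id x : 0 <=v x -> vabs x = x.
Proof.
move=> h; rewrite vabsE (vpos_id h) vpos_eq0 ?addr0 //.
by rewrite -vsub_ge0 sub0r opprK.
Qed.

Lemma vabsD x y : vabs (x + y) <=v vabs x + vabs y.
Proof.
by apply: vabs_lub; rewrite ?opprD; apply: vleD; rewrite ?vabs_ge ?vabs_geN.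
Qed.

Lemma vabs_subC x y : vabs (x - y) = vabs (y - x).
Proof. by rewrite -vabsN opprB. Qed.

Lemma vpos_le_abs x : vpos x <=v vabs x.
Proof. by apply: vpos_lub; rewrite ?vabs_ge ?vabs_ge0. Qed.

Lemma vabs_norm x : `|vabs x| = `|x|.
Proof.
have h y : vjoin y (- y) = vabs y by [].
by apply/le_anti/andP; split; apply: vnorm_le; rewrite !h (vabs_id (vabs_ge0 x));
   exact: vle_refl.
Qed.

Lemma vnorm_abs x y : vabs x <=v vabs y -> `|x| <= `|y|.
Proof. exact: vnorm_le. Qed.

Lemma vnorm_abs_le x y : vabs x <=v y -> `|x| <= `|y|.
Proof. by move=> h; apply: vnorm_abs; exact: vle_tr h (vabs_ge _). Qed.

Lemma vnorm_mono x y : 0 <=v x -> x <=v y -> `|x| <= `|y|.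
Proof. by move=> x0 xy; apply: vnorm_abs_le; rewrite vabs_id. Qed.

Lemma vnorm_pos x : `|vpos x| <= `|x|.
Proof.
by rewrite -(vabs_norm x); apply: vnorm_mono; rewrite ?vpos_ge0 ?vpos_le_abs.
Qed.

End vector_lattice.

(** * Functionals and the Hahn-Banach theorem *)

Section linear_functionals.
Context {R : realType} {V W : normedModType R}.
Implicit Types (f : V -> W) (u v : V).

Lemma linD f u v : linear f -> f (u + v) = f u + f v.
Proof. by move=> lf; have := lf 1 u v; rewrite !scale1r. Qed.

Lemma lin0 f : linear f -> f 0 = 0.
Proof.
move=> lf; have h := linD 0 0 lf; rewrite addr0 in h.
by apply: (@addrI _ (f 0)); rewrite addr0 -h.
Qed.

Lemma linZ f (t : R) u : linear f -> f (t *: u) = t *: f u.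
Proof. by move=> lf; have := lf t u 0; rewrite (lin0 lf) !addr0. Qed.

Lemma linN f u : linear f -> f (- u) = - f u.
Proof. by move=> lf; rewrite -scaleN1r linZ // scaleN1r. Qed.

Lemma linB f u v : linear f -> f (u - v) = f u - f v.
Proof. by move=> lf; rewrite linD // linN. Qed.

End linear_functionals.

Section hahn_banach.
Context {R : realType} {V : normedModType R}.
Implicit Types (p q : V -> R) (x y z : V).

Definition sublinear p : Prop :=
  (forall x y, p (x + y) <= p x + p y) /\
  (forall (t : R) x, 0 <= t -> p (t *: x) = t * p x).

Lemma sublinearP p : (forall x y, p (x + y) <= p x + p y) -> p 0 = 0 ->
  (forall (t : R) x, 0 < t -> p (t *: x) <= t * p x) -> sublinear p.
Proof.
move=> pD p0 pZ; split=> // t x; rewrite le_eqVlt => /orP[/eqP<-|t0].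
  by rewrite scale0r mul0r.
apply/le_anti/andP; split; first exact: pZ.
have := pZ t^-1 (t *: x); rewrite scalerA mulVf ?lt0r_neq0 // scale1r.
by rewrite invr_gt0 => /(_ t0); rewrite ler_pdivlMl.
Qed.

Lemma sublinear0 p : sublinear p -> p 0 = 0.
Proof. by case=> _ /(_ 0 0 (lexx _)); rewrite scale0r mul0r. Qed.

Lemma sublinear_ge p x : sublinear p -> - p (- x) <= p x.
Proof.
move=> sp; rewrite -subr_ge0 opprK -(sublinear0 sp) -(subrr x).
by case: sp => + _; apply.
Qed.

(** Replacing [p] by this smaller sublinear functional forces linearity along
    the direction [a]. *)
Definition flatten_along p a x : R :=
  inf [set p (x + t *: a) - t * p a | t in [set t : R | 0 <= t]].

Section flatten.
Variables (p : V -> R) (a : V).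
Hypothesis sp : sublinear p.

Let S x := [set p (x + t *: a) - t * p a | t in [set t : R | 0 <= t]].

Let S_ne x : S x !=set0.
Proof. by exists (p (x + 0 *: a) - 0 * p a); exists 0 => //=. Qed.

Let S_lb x : lbound (S x) (- p (- x)).
Proof.
move=> _ [t t0 <-]; rewrite -(proj2 sp _ _ t0).
have := proj1 sp (x + t *: a) (- x); rewrite addrAC subrr add0r; lra.
Qed.

Let S_hlb x : has_lbound (S x).
Proof. by exists (- p (- x)); exact: S_lb. Qed.

Lemma flatten_along_le x (t : R) : 0 <= t ->
  flatten_along p a x <= p (x + t *: a) - t * p a.
Proof. by move=> t0; apply: ge_inf; [exact: S_hlb|exists t]. Qed.

Lemma flatten_along_le_self x : flatten_along p a x <= p x.
Proof.
by apply: (le_trans (flatten_along_le x (lexx 0))); rewrite scale0r addr0 mul0r subr0.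
Qed.

Lemma le_flatten_along x r :
  (forall t : R, 0 <= t -> r <= p (x + t *: a) - t * p a) ->
  r <= flatten_along p a x.
Proof. by move=> h; apply: lb_le_inf => [|_ [t t0 <-]]; [exact: S_ne|exact: h]. Qed.

Lemma sublinear_flatten_along : sublinear (flatten_along p a).
Proof.
apply: sublinearP => [x y||t x t0].
- rewrite -lerBlDr; apply: le_flatten_along => t t0.
  rewrite lerBlDr -lerBlDl; apply: le_flatten_along => s s0.
  have := flatten_along_le (x + y) (addr_ge0 t0 s0).
  have := proj1 sp (x + t *: a) (y + s *: a).
  have -> : x + t *: a + (y + s *: a) = x + y + (t + s) *: a by vmod.
  lra.
- apply/le_anti/andP; split.
    by apply: (le_trans (flatten_along_le_self 0)); rewrite sublinear0.
  by apply: le_flatten_along => s s0; rewrite add0r (proj2 sp _ _ s0) subrr.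
- rewrite -ler_pdivrMl //; apply: le_flatten_along => s s0.
  rewrite ler_pdivrMl //.
  apply: (le_trans (flatten_along_le (t *: x) (mulr_ge0 (ltW t0) s0))).
  by rewrite -scalerA -scalerDr (proj2 sp _ _ (ltW t0)) mulrBr mulrA.
Qed.

Lemma flatten_alongN : flatten_along p a (- a) <= - p a.
Proof.
apply: (le_trans (flatten_along_le (- a) ler01)).
by rewrite scale1r addNr (sublinear0 sp) mul1r sub0r.
Qed.

End flatten.

(** A minimal sublinear functional below [p] is linear, because flattening it
    along a vector cannot make it smaller; such a functional exists by Zorn's
    lemma. *)
Theorem hahn_banach p x0 : sublinear p ->
  exists f : V -> R, [/\ linear f, forall x, f x <= p x & f x0 = p x0].
Proof.
move=> sp0; pose p1 := flatten_along p x0.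
have sp : sublinear p1 by exact: sublinear_flatten_along.
pose T := {q : V -> R | sublinear q /\ forall x, q x <= p1 x}.
pose le_T (s t : T) := `[< forall x, sval t x <= sval s x >].
have [t tmin] : exists t : T, forall s, le_T t s -> s = t.
  apply: (@Zorn T le_T).
  - by move=> t; apply/asboolP.
  - move=> r s t /asboolP rs /asboolP st; apply/asboolP => x.
    exact: le_trans (st x) (rs x).
  - move=> [s Ps] [t Pt] /asboolP /= st /asboolP /= ts; apply: eq_exist.
    by apply/funext => x; apply/le_anti; rewrite st ts.
  move=> A Atot; case: (pselect (A !=set0)) => [[s0 As0]|A0]; last first.
    exists (exist _ p1 (conj sp (fun x => lexx _))) => s As.
    by case: A0; exists s.
  pose S x := [set sval s x | s in A].
  have S_ne x : S x !=set0 by exists (sval s0 x); exists s0.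
  have S_lb x : has_lbound (S x).
    exists (- p1 (- x)) => _ [[s [ss sle]] _ <-] /=.
    by apply: le_trans (sublinear_ge x ss); rewrite lerN2.
  pose q x := inf (S x).
  have q_le s x : A s -> q x <= sval s x by move=> As; apply: ge_inf; [exact: S_lb|exists s].
  have le_q r x : (forall s, A s -> r <= sval s x) -> r <= q x.
    by move=> h; apply: lb_le_inf => [|_ [s As <-]]; [exact: S_ne|exact: h].
  have sq : sublinear q.
    apply: sublinearP => [x y||c x c0].
    - rewrite -lerBlDr; apply: (le_q) => s As.
      rewrite lerBlDr -lerBlDl; apply: (le_q) => u Au.
      rewrite lerBlDl; case: (Atot s u As Au) => /asboolP su.
        apply: (le_trans (q_le u _ Au)); case: (svalP u) => -[uD _] _.
        by apply: (le_trans (uD _ _)); rewrite lerD2r.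
      apply: (le_trans (q_le s _ As)); case: (svalP s) => -[sD _] _.
      by apply: (le_trans (sD _ _)); rewrite lerD2l.
    - apply/le_anti/andP; split.
        apply: (le_trans (q_le _ _ As0)); case: (svalP s0) => ss _.
        by rewrite sublinear0.
      by apply: (le_q) => s As; case: (svalP s) => ss _; rewrite sublinear0.
    - rewrite -ler_pdivrMl //; apply: (le_q) => s As.
      rewrite ler_pdivrMl //; apply: (le_trans (q_le _ _ As)).
      by case: (svalP s) => -[_ sZ] _; rewrite sZ // ltW.
  have qp x : q x <= p1 x.
    by apply: (le_trans (q_le _ _ As0)); case: (svalP s0).
  exists (exist _ q (conj sq qp)) => s As; apply/asboolP => x /=; exact: q_le.
case: t tmin => f [sf fp] /= fmin.
have fN a : f (- a) = - f a.
  have sfa := sublinear_flatten_along a sf.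
  have hle x : flatten_along f a x <= p1 x.
    exact: le_trans (flatten_along_le_self a sf x) (fp x).
  have /fmin[e] : le_T (exist _ f (conj sf fp)) (exist _ _ (conj sfa hle)).
    by apply/asboolP => x /=; exact: flatten_along_le_self.
  apply/le_anti/andP; split; first by rewrite -[X in X (- a) <= _]e; exact: (flatten_alongN a sf).
  by have := sublinear_ge (- a) (sf); rewrite opprK.
have fZ (t : R) x : f (t *: x) = t * f x.
  case: (leP 0 t) => [|t0]; first by exact: (proj2 sf).
  have -> : t *: x = - ((- t) *: x) by rewrite scaleNr opprK.
  by rewrite fN (proj2 sf) ?oppr_ge0 ?ltW // mulNr opprK.
have fD x y : f (x + y) = f x + f y.
  apply/le_anti/andP; split; first exact: (proj1 sf).
  have := proj1 sf (x + y) (- y); rewrite addrK fN; lra.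
exists f; split=> [t x y|x|]; first by rewrite fD fZ.
  exact: le_trans (fp x) (flatten_along_le_self x0 sp0 x).
apply/le_anti/andP; split.
  exact: le_trans (fp x0) (flatten_along_le_self x0 sp0 x0).
rewrite -lerN2 -fN; apply: (le_trans (fp _)).
exact: (flatten_alongN x0 sp0).
Qed.

End hahn_banach.

(** * Bounded operators and weak-star limits *)

Section bounded_operators.
Context {R : realType} {V W : normedModType R}.
Implicit Types (T : V -> W) (x y : V).

Lemma bounded_op_of_bound T (M : R) : linear T ->
  (forall x, `|T x| <= M * `|x|) -> bounded_op T.
Proof.
move=> lT hM; split=> // x; apply/cvgrPdist_le => e e0.
have M1 : 0 < `|M| + 1 by rewrite ltr_wpDl.
near=> y; rewrite -linB //; apply: (le_trans (hM _)).
have h : `|x - y| <= e / (`|M| + 1).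
  by near: y; apply: cvgr_dist_le => //; rewrite divr_gt0.
apply: (@le_trans _ _ ((`|M| + 1) * `|x - y|)).
  by apply: ler_wpM2r => //; rewrite (le_trans (ler_norm M)) // lerDl.
by rewrite mulrC -ler_pdivlMr.
Unshelve. all: by end_near.
Qed.

Lemma bounded_op_bound T : bounded_op T ->
  exists M : R, forall x, `|T x| <= M * `|x|.
Proof.
move=> [lT cT].
have /cvgrPdist_lt/(_ 1 ltr01) : T x @[x --> (0 : V)] --> T 0 by exact: cT.
rewrite (lin0 lT) => /nbhs_ballP[d /= d0 hd].
exists (2 / d) => x; have [->|x0] := eqVneq x 0.
  by rewrite (lin0 lT) !normr0 mulr0.
have nx : 0 < `|x| by rewrite normr_gt0.
pose t := d / (2 * `|x|).
have t0 : 0 < t by rewrite divr_gt0 // mulr_gt0.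
have : `|T (t *: x)| < 1.
  rewrite -normrN -sub0r; apply: hd; rewrite -ball_normE /= sub0r normrN normrZ.
  rewrite gtr0_norm // /t.
  have -> : d / (2 * `|x|) * `|x| = d / 2 by field; rewrite lt0r_neq0.
  lra.
rewrite linZ // normrZ gtr0_norm // => h.
have -> : 2 / d * `|x| = t^-1 by rewrite /t; field; rewrite !lt0r_neq0.
by rewrite -[leRHS]mulr1 ler_pdivlMl // ltW.
Qed.

Lemma opnorm_bound T x : bounded_op T -> `|T x| <= opnorm T * `|x|.
Proof.
move=> bT; have [M hM] := bounded_op_bound bT; have lT := proj1 bT.
have [->|x0] := eqVneq x 0; first by rewrite (lin0 lT) !normr0 mulr0.
have nx : 0 < `|x| by rewrite normr_gt0.
rewrite -ler_pdivrMr //; apply: sup_ubound.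
  exists `|M| => _ [y /= y1 <-]; apply: (le_trans (hM y)).
  apply: (le_trans (ler_norm _)); rewrite normrM normr_id.
  by rewrite -[leRHS]mulr1 ler_wpM2l.
exists (`|x|^-1 *: x) => /=; last by rewrite linZ // normrZ gtr0_norm ?invr_gt0 // mulrC.
by rewrite normrZ gtr0_norm ?invr_gt0 // mulVf ?lt0r_neq0.
Qed.

Lemma opnorm_le T (M : R) : bounded_op T ->
  (forall x, `|x| <= 1 -> `|T x| <= M) -> opnorm T <= M.
Proof.
move=> bT h; apply: ge_sup => [|_ [x /= x1 <-]]; last exact: h.
by exists `|T 0|; exists 0 => //=; rewrite normr0.
Qed.

Lemma opnorm_ge0 T : bounded_op T -> 0 <= opnorm T.
Proof.
move=> bT; have lT := proj1 bT; have [M hM] := bounded_op_bound bT.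
apply: (@le_trans _ _ `|T 0|); first exact: normr_ge0.
apply: sup_ubound; last by exists 0 => //=; rewrite normr0.
exists `|M| => _ [y /= y1 <-]; apply: (le_trans (hM y)).
apply: (le_trans (ler_norm _)); rewrite normrM normr_id.
by rewrite -[leRHS]mulr1 ler_wpM2l.
Qed.

End bounded_operators.

Lemma ultra_cvg (R : realType) (T : Type) (F : set_system T) (f : T -> R) (K : R) :
  UltraFilter F -> F [set z | `|f z| <= K] -> exists l : R, f @ F --> l.
Proof.
move=> UF FK; have PF : ProperFilter F by exact: ultra_proper.
have [|l [_ lcl]] := @segment_compact R (- K) K (f @ F) (fmap_proper_filter f PF).
  suff : F (f @^-1` [set` `[- K, K]]) by [].
  by apply: filterS FK => z /=; rewrite in_itv /= ler_norml.
exists l => A Al; have [//|FnA] := in_ultra_setVsetC (f @^-1` A) UF.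
by have [y []] := lcl (~` A) A FnA Al.
Qed.

Section weak_star.
Context {R : realType} {X Y : normedModType R} (J : X -> Y -> R).
Hypothesis HJ : dual_identification J.
Implicit Types (x z : X) (y : Y) (F : set_system X).

Lemma pair_linear x : linear (J x).
Proof. by case: HJ => _ /(_ x)[]. Qed.

Lemma pairDl x z y : J (x + z) y = J x y + J z y.
Proof. by case: HJ => lJ _ _ _; have := lJ 1 x z; rewrite !scale1r => ->. Qed.

Lemma pair0l y : J 0 y = 0.
Proof. by apply: (@addrI _ (J 0 y)); rewrite -pairDl !addr0. Qed.

Lemma pairZl (t : R) x y : J (t *: x) y = t * J x y.
Proof.
case: HJ => lJ _ _ _; have := lJ t x 0; rewrite addr0 => ->.
by transitivity (t * J x y + J 0 y); [|rewrite pair0l addr0].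
Qed.

Lemma pairNl x y : J (- x) y = - J x y.
Proof. by rewrite -scaleN1r pairZl mulN1r. Qed.

Lemma pairBl x z y : J (x - z) y = J x y - J z y.
Proof. by rewrite pairDl pairNl. Qed.

Lemma pair_bound x y : `|J x y| <= `|x| * `|y|.
Proof. by case: HJ => _ bJ <- _; exact: opnorm_bound. Qed.

Lemma norm_le_pair x (M : R) :
  (forall y, `|y| <= 1 -> `|J x y| <= M) -> `|x| <= M.
Proof. by case: HJ => _ bJ <- _; exact: opnorm_le. Qed.

Lemma pair_inj x z : (forall y, J x y = J z y) -> x = z.
Proof.
move=> h; apply/eqP; rewrite -subr_eq0 -normr_le0; apply: norm_le_pair => y _.
by rewrite pairBl h subrr normr0.
Qed.

Lemma pair_represent (g : Y -> R) (M : R) : linear g ->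
  (forall y, `|g y| <= M * `|y|) -> exists x, J x = g.
Proof. by move=> lg hg; case: HJ => _ _ _; apply; exact: bounded_op_of_bound hg. Qed.

Definition wstar_cvg F x := forall y, J^~ y @ F --> J x y.

(** The Banach-Alaoglu theorem, in terms of ultrafilters. *)
Lemma wstar_compact F (M : R) : UltraFilter F -> F [set z | `|z| <= M] ->
  exists x, wstar_cvg F x.
Proof.
move=> UF FM; have PF : ProperFilter F by exact: ultra_proper.
have ex y : exists l : R, J^~ y @ F --> l.
  apply: (@ultra_cvg _ _ _ _ (M * `|y|)); apply: filterS FM => z /= zM.
  by apply: (le_trans (pair_bound _ _)); rewrite ler_wpM2r.
have [g hg] := choice ex.
have lg : linear g.
  move=> t u v; apply/esym/(cvg_unique _ _ (hg _)) => //.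
  have -> : J^~ (t *: u + v) = (fun z => t * J z u + J z v).
    by apply/funext => z; exact: pair_linear.
  apply: cvgD => //; apply: cvgMr => //; exact: cvg_cst.
have [y|x hx] := @pair_represent g M lg.
  apply: (@closed_cvg _ _ _ PF (fun z => J z y) [set l : R | `|l| <= M * `|y|]) => //.
    apply: (@closed_comp _ _ (fun l : R => `|l|) [set l : R | l <= M * `|y|]).
      by move=> l _; exact: norm_continuous.
    exact: closed_le.
  apply: filterS FM => z /= zM.
  by apply: (le_trans (pair_bound _ _)); rewrite ler_wpM2r.
by exists x => y; rewrite hx.
Qed.

Lemma wstar_pair_le F x y (C : R) : ProperFilter F -> wstar_cvg F x ->
  F [set z | J z y <= C] -> J x y <= C.
Proof.
move=> PF Fx FC; apply: (@closed_cvg _ _ _ PF (fun z => J z y) [set l : R | l <= C]).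
- exact: closed_le.
- exact: FC.
- exact: Fx.
Qed.

(** The norm is weak-star lower semicontinuous. *)
Lemma wstar_norm_le F x c (M : R) : ProperFilter F -> wstar_cvg F x ->
  F [set z | `|c + z| <= M] -> `|c + x| <= M.
Proof.
move=> PF Fx FM; apply: norm_le_pair => y y1.
have hz z : `|c + z| <= M -> `|J (c + z) y| <= M.
  move=> h; apply: (le_trans (pair_bound _ _)).
  by rewrite -[leRHS]mulr1 ler_pM.
rewrite ler_norml; apply/andP; split.
  suff : J x (- y) <= M + J c y.
    rewrite (linN y (pair_linear x)) pairDl; lra.
  apply: (wstar_pair_le PF Fx); apply: filterS FM => z /hz.
  by rewrite /= ler_norml pairDl (linN y (pair_linear z)); lra.
suff : J x y <= M - J c y by rewrite pairDl; lra.
apply: (wstar_pair_le PF Fx); apply: filterS FM => z /hz.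
by rewrite /= ler_norml pairDl; lra.
Qed.

End weak_star.

(** * Suprema of directed sets *)

Section norm_of_sum.
Context {R : realType} {X : banachLatticeType R}.
Implicit Types (x y z a b c d u v w e : X) (t : R).

Lemma sublinear_norm_pos : sublinear (fun x : X => `|vpos x|).
Proof.
split=> [x y|t x t0]; last by rewrite vposZ // normrZ ger0_norm.
by apply: le_trans (ler_normD _ _); apply: vnorm_mono (vposD x y); exact: vpos_ge0.
Qed.

Lemma positive_norming u : 0 <=v u -> exists k : X -> R,
  [/\ linear k, positive_functional k, forall x, k x <= `|x| & k u = `|u|].
Proof.
move=> u0; have [k [lk kle ku]] := hahn_banach u sublinear_norm_pos.
exists k; split=> // [x x0|x|]; last by rewrite ku vpos_id.
  have := kle (- x); rewrite linN // (@vpos_eq0 _ _ (- x)) ?normr0; first lra.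
  by rewrite -(oppr0 X) vleN.
exact: le_trans (kle x) (vnorm_pos x).
Qed.

Lemma positive_mono (k : X -> R) x y :
  linear k -> positive_functional k -> x <=v y -> k x <= k y.
Proof.
by move=> lk k0; rewrite -vsub_ge0 => /k0; rewrite (linB _ _ lk) subr_ge0.
Qed.

Section component.
Variables (k : X -> R) (d : X).
Hypotheses (lk : linear k) (k0 : positive_functional k) (d0 : 0 <=v d).

(** On the positive cone, the component of the positive functional [k] in the
    band generated by [d]. *)
Definition component x : R := sup (range (fun n : nat => k (vmeet x (n%:R *: d)))).

Let nd_ge0 n : 0 <=v n%:R *: d.
Proof. by apply: vscale_ge0. Qed.

Lemma le_component n x : k (vmeet x (n%:R *: d)) <= component x.
Proof.
apply: sup_ubound; last by exists n.
by exists (k x) => _ [m _ <-]; apply: positive_mono => //; exact: vmeet_l.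
Qed.

Lemma component_le x (M : R) :
  (forall n, k (vmeet x (n%:R *: d)) <= M) -> component x <= M.
Proof.
move=> h; apply: ge_sup => [|_ [n _ <-]]; last exact: h.
by exists (k (vmeet x (0%:R *: d))); exists 0%N.
Qed.

Lemma component_ge0 x : 0 <=v x -> 0 <= component x.
Proof.
by move=> x0; apply: le_trans (le_component 0 x); apply/k0/vmeet_ge0.
Qed.

Lemma component_le_self x : component x <= k x.
Proof. by apply: component_le => n; apply: positive_mono => //; exact: vmeet_l. Qed.

(** The infimum with a multiple of [d] is subadditive on the positive cone, and
    it is superadditive up to the sum of the multiples, which the supremum over
    all multiples absorbs. *)
Lemma componentD x y : 0 <=v x -> 0 <=v y ->
  component (x + y) = component x + component y.
Proof.
move=> x0 y0; apply/le_anti/andP; split.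
  apply: component_le => n.
  apply: (@le_trans _ _ (k (vmeet x (n%:R *: d)) + k (vmeet y (n%:R *: d)))).
    by rewrite -(linD _ _ lk); apply: positive_mono => //; exact: vmeet_addl.
  by apply: lerD; exact: le_component.
rewrite -lerBrDr; apply: component_le => n; rewrite lerBrDr -lerBrDl.
apply: component_le => m; rewrite lerBrDl -(linD _ _ lk).
apply: le_trans (le_component (n + m) (x + y)); apply: positive_mono => //.
by rewrite natrD scalerDl; exact: vmeet_add.
Qed.

(** The functional obtained from [k] by changing its sign on the band
    generated by [d]. *)
Definition reflect x : R := k x - 2 * (component (vpos x) - component (vpos (- x))).

Lemma reflectD x y : reflect (x + y) = reflect x + reflect y.
Proof.
have e : vpos (x + y) + (vpos (- x) + vpos (- y)) =
         vpos (- (x + y)) + (vpos x + vpos y).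
  have -> : vpos (x + y) = vpos (- (x + y)) + (x + y).
    by rewrite -{3}(vposB (x + y)); vmod.
  by rewrite -{2}(vposB x) -{2}(vposB y); vmod.
have := congr1 component e.
rewrite !componentD ?vaddr_ge0 ?vpos_ge0 // /reflect (linD _ _ lk); lra.
Qed.

Lemma reflect_pos x : 0 <=v x -> reflect x = k x - 2 * component x.
Proof.
move=> x0; have n0 : - x <=v 0 by rewrite -(oppr0 X) vleN.
have c0 : component 0 = 0.
  apply/le_anti; rewrite component_ge0 ?vle_refl // andbT.
  by rewrite (le_trans (component_le_self 0)) // (lin0 lk).
by rewrite /reflect vpos_id // vpos_eq0 // c0 subr0.
Qed.

Lemma reflect_le x : reflect x <= k (vabs x).
Proof.
have kp := component_le_self (vpos x); have kn := component_le_self (vpos (- x)).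
have cp := component_ge0 (vpos_ge0 x); have cn := component_ge0 (vpos_ge0 (- x)).
rewrite vabsE (linD _ _ lk) /reflect -{1}(vposB x) (linB _ _ lk); lra.
Qed.

End component.

Lemma vmeet_scale_eq0 a b n : 0 <=v a -> 0 <=v b -> vmeet a b = 0 ->
  vmeet a (n%:R *: b) = 0.
Proof.
move=> a0 b0 ab; elim: n => [|n IHn].
  by rewrite scale0r vmeetC vmeet_idl.
apply: vle_asym; last by apply: vmeet_ge0 => //; exact: vscale_ge0.
rewrite -natr1 scalerDl scale1r vmeetC.
apply: (vle_tr (vmeet_addl (vscale_ge0 _ _ (ler0n R n) b0) b0 a0)).
by rewrite !(vmeetC _ a) IHn ab addr0 vle_refl.
Qed.

(** In a function space, [v = u] where [c] is positive and [v = - u] where it is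
    negative gives [|v + c| = u + |c|]. A Banach lattice need not have the band
    projections that define this [v]. Instead, a positive functional [k] that
    norms [u + |c|] is reflected at the band of [c^-], and [v = u - 2 (u /\ n c^-)]
    comes close to the supremum of the reflected functional. *)
Lemma norm_add_abs_le u c (M : R) : 0 <=v u ->
  (forall v, vabs v <=v u -> `|v + c| <= M) -> `|u + vabs c| <= M.
Proof.
move=> u0 hM; have c0 := vabs_ge0 c.
have [k [lk k0 kle <-]] := positive_norming (vaddr_ge0 u0 c0).
pose d := vpos (- c); have d0 : 0 <=v d := vpos_ge0 _.
have hc : reflect k d c = k (vabs c).
  have cp : component k d (vpos c) <= 0.
    apply: component_le => n.
    by rewrite vmeet_scale_eq0 ?vpos_ge0 ?vmeet_pos_neg // (lin0 lk).
  have cp' := component_ge0 lk k0 d0 (vpos_ge0 c).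
  have cn : k d <= component k d d.
    apply: le_trans (le_component d lk k0 1 d).
    by rewrite scale1r vmeet_idl ?vle_refl.
  have cn' := component_le_self d lk k0 d.
  rewrite /reflect vabsE (linD _ _ lk) -{1}(vposB c) (linB _ _ lk); rewrite -/d; lra.
(* [u - e - e] is [- u] where [n d] exceeds [u], and [u] where [d] vanishes. *)
have hv n : k (vmeet u (n%:R *: d)) <= (M - k u - k (vabs c)) / 2 + component k d u.
  set e := vmeet u _.
  have e0 : 0 <=v e by apply: vmeet_ge0 => //; exact: vscale_ge0.
  have eu : e <=v u by exact: vmeet_l.
  have ce : component k d e = k e.
    apply/le_anti; rewrite component_le_self //=.
    apply: le_trans (le_component d lk k0 n e).
    by rewrite vmeet_idl ?vle_refl //; exact: vmeet_r.
  have Mv : `|u - e - e + c| <= M.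
    by apply: hM; apply: vabs_lub; [apply: (vle_of2 e0 e0)|apply: (vle_of2 eu eu)]; vmod.
  have := le_trans (reflect_le lk k0 d0 (u - e - e + c)) (le_trans (kle _) _).
  move=> /(_ M); rewrite vabs_norm => /(_ Mv).
  have -> : reflect k d (u - e - e + c) = reflect k d u - 2 * reflect k d e + k (vabs c).
    rewrite reflectD // hc; congr (_ + _).
    have : reflect k d (u - e - e + (e + e)) = reflect k d u by congr reflect; vmod.
    rewrite !(reflectD lk k0 d0 _ (e + e)) (reflectD lk k0 d0 e e); lra.
  rewrite !reflect_pos // ce; lra.
have := component_le hv; rewrite (linD _ _ lk); lra.
Qed.

End norm_of_sum.

Section directed.
Context {R : realType} {X : banachLatticeType R}.
Implicit Types (x y z a b c d u v w e : X) (S : set X).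

Definition is_vsup S x : Prop :=
  (forall a, S a -> a <=v x) /\ (forall w, (forall a, S a -> a <=v w) -> x <=v w).

Definition directed S : Prop :=
  forall a b, S a -> S b -> exists c, [/\ S c, a <=v c & b <=v c].

Lemma norm_multiples_eq0 a (M : R) : (forall n, `|n%:R *: a| <= M) -> a = 0.
Proof.
move=> h; apply/eqP; rewrite -normr_le0 leNgt; apply/negP => a0.
have := archi_boundP (ltW a0).
have [n hn] : exists n, M / `|a| < n%:R.
  have M0 : 0 <= M / `|a|.
    by rewrite divr_ge0 //; apply: le_trans (h 0%N); exact: normr_ge0.
  by exists (Num.bound (M / `|a|)); exact: archi_boundP.
move=> _; have := h n; rewrite normrZ normr_nat leNgt => /negP; apply.
by rewrite -ltr_pdivrMr.
Qed.

(** A weak-star cluster point [s] of the increasing net [S] satisfies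
    [|a + b + |s - a|| <= sup |z + b|] for [a] in [S] and every positive [b].
    A lower bound of the [|s - a|] can therefore be added to [b] repeatedly
    without increase of the norm, so it is zero; this is what makes [s] the
    supremum. *)
Theorem directed_sup (Y : normedModType R) (J : X -> Y -> R) S e :
  dual_identification J -> S !=set0 -> directed S ->
  (forall a, S a -> 0 <=v a /\ a <=v e) ->
  exists s, is_vsup S s /\
    forall (y : Y) (M : R), (forall a, S a -> J a y <= M) -> J s y <= M.
Proof.
move=> HJ [a00 Sa00] dS bS.
pose G a := [set z | S z /\ a <=v z].
have PF : ProperFilter (filter_from S G).
  apply: filter_from_proper; last by move=> a Sa; exists a; split; rewrite ?vle_refl.
  apply: filter_from_filter; first by exists a00.
  move=> a b Sa Sb; have [c [Sc ac bc]] := dS a b Sa Sb.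
  by exists c => // z [Sz cz]; split; split=> //; [exact: vle_tr cz|exact: vle_tr cz].
have [U [UU FU]] := ultraFilterLemma PF.
have PU : ProperFilter U by exact: ultra_proper.
have UG a : S a -> U (G a) by move=> Sa; apply: FU; exists a.
have [s Us] : exists s, wstar_cvg J U s.
  apply: (@wstar_compact _ _ _ _ HJ U `|e|) => //.
  apply: filterS (UG a00 Sa00) => z [Sz _] /=.
  by have [z0 ze] := bS z Sz; exact: vnorm_mono.
(* For [|v| <= a + b] and [z] in [S] above [a], [|v + (z - a)| <= z + b]. *)
have key a b (M : R) : S a -> 0 <=v b -> (forall z, S z -> `|z + b| <= M) ->
    `|a + b + vabs (s - a)| <= M.
  move=> Sa b0 hM; have [a0 _] := bS a Sa.
  apply: norm_add_abs_le => [|v va]; first exact: vaddr_ge0.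
  have -> : v + (s - a) = v - a + s by vmod.
  apply: (wstar_norm_le HJ PU Us); apply: filterS (UG a Sa) => z [Sz az] /=.
  apply: le_trans (hM z Sz); apply: vnorm_abs_le.
  have -> : v - a + z = v + (z - a) by vmod.
  apply: (vle_tr (vabsD _ _)); rewrite (@vabs_id _ _ (z - a)) ?vsub_ge0 //.
  by apply: (vle_of1 va); vmod.
have small a0 t : S a0 -> 0 <=v t ->
    (forall a, S a -> a0 <=v a -> t <=v vabs (s - a)) -> t = 0.
  move=> Sa0 t0 ht.
  (* Each step replaces [b] by [b + t] without change of the bound. *)
  have hn n : forall a, S a -> `|a + n%:R *: t| <= `|e|.
    elim: n => [|n IHn] a Sa; have [b0 be] := bS a Sa.
      by rewrite scale0r addr0; exact: vnorm_mono.
    have [a' [Sa' aa' a0a']] := dS a a0 Sa Sa0.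
    have nt0 : 0 <=v n%:R *: t by exact: vscale_ge0.
    apply: le_trans (key a' _ _ Sa' nt0 IHn); apply: vnorm_mono.
      by apply: vaddr_ge0 => //; exact: vscale_ge0.
    rewrite -natr1; apply: (vle_of2 aa' (ht a' Sa' a0a')); vmod.
  apply: (@norm_multiples_eq0 _ `|e|) => n; apply: le_trans (hn n a0 Sa0).
  have [a0_ge0 _] := bS a0 Sa0; apply: vnorm_mono; first exact: vscale_ge0.
  by apply: (vle_of1 a0_ge0); vmod.
have le0 x : vpos x = 0 -> x <=v 0 by move=> <-; exact: vpos_ge.
exists s; split; last first.
  move=> y M hM; apply: (wstar_pair_le PU Us).
  by apply: filterS (UG a00 Sa00) => z [Sz _]; exact: hM.
split=> [a Sa|w hw].
  rewrite -vsub_ge0 -vleN oppr0 opprB; apply: le0.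
  apply: (small a) => //; first exact: vpos_ge0.
  move=> a' Sa' aa'; rewrite vabs_subC; apply: vle_tr (vpos_le_abs _).
  by apply: vpos_mono; apply: (vle_of1 aa'); vmod.
rewrite -vsub_ge0 -vleN oppr0 opprB; apply: le0.
apply: (small a00) => //; first exact: vpos_ge0.
move=> a' Sa' aa'; apply: vle_tr (vpos_le_abs _).
by apply: vpos_mono; apply: (vle_of1 (hw a' Sa')); vmod.
Qed.

End directed.

(** * Positive parts of functionals and order continuity *)

Section positive_part.
Context {R : realType} {X : banachLatticeType R} {Y : normedModType R}.
Variable J : X -> Y -> R.
Hypothesis HJ : dual_identification J.
Implicit Types (x z a b c d u v w e : X) (S : set X) (y : Y).

Lemma is_vsup_unique S a b : is_vsup S a -> is_vsup S b -> a = b.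
Proof. by move=> [ua la] [ub lb]; apply: vle_asym; [exact: la|exact: lb]. Qed.

Lemma vsup_pair_le S e s y (M : R) : S !=set0 -> directed S ->
  (forall a, S a -> 0 <=v a /\ a <=v e) -> is_vsup S s ->
  (forall a, S a -> J a y <= M) -> J s y <= M.
Proof.
move=> S0 dS bS ss; have [s' [ss' h]] := directed_sup HJ S0 dS bS.
by rewrite (is_vsup_unique ss ss'); exact: h.
Qed.

Lemma vsup_meet S s v : is_vsup S s -> v <=v s -> is_vsup (vmeet v @` S) v.
Proof.
move=> [ub lb] vs; split=> [_ [u _ <-]|w hw]; first exact: vmeet_l.
suff h : s <=v w + (s - v) by apply: (vle_of1 h); vmod.
apply: lb => u Su; have uv : v + u - s <=v w.
  apply: vle_tr (hw _ (imageP _ Su)); apply: vmeet_glb.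
    by apply: (vle_of1 (ub u Su)); vmod.
  by apply: (vle_of1 vs); vmod.
by apply: (vle_of1 uv); vmod.
Qed.

Lemma directed_meet S v : directed S -> directed (vmeet v @` S).
Proof.
move=> dS _ _ [a Sa <-] [b Sb <-]; have [c [Sc ac bc]] := dS a b Sa Sb.
exists (vmeet v c); split; first exact: imageP.
  exact: vmeet_mono (vle_refl _) ac.
exact: vmeet_mono (vle_refl _) bc.
Qed.

Lemma vsub_meet_le v a b : 0 <=v b -> v <=v a + b -> v - vmeet v a <=v b.
Proof.
move=> b0 vab; rewrite vsub_meet; apply: vpos_lub => //.
by apply: (vle_of1 vab); vmod.
Qed.

Lemma vsub_meet_ge0 v a : 0 <=v v - vmeet v a.
Proof. by rewrite vsub_ge0; exact: vmeet_l. Qed.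

(** The positive part of the functional [J^~ y], on the positive cone. *)
Definition pospart y u : R := sup [set J v y | v in [set v | 0 <=v v /\ v <=v u]].

Lemma le_pospart y u v : 0 <=v v -> v <=v u -> J v y <= pospart y u.
Proof.
move=> v0 vu; apply: sup_ubound; last by exists v.
exists (`|u| * `|y|) => _ [z [z0 zu] <-]; apply: (le_trans (ler_norm _)).
apply: (le_trans (pair_bound HJ z y)); rewrite ler_wpM2r //; exact: vnorm_mono.
Qed.

Lemma pospart_le y u (M : R) : 0 <=v u ->
  (forall v, 0 <=v v -> v <=v u -> J v y <= M) -> pospart y u <= M.
Proof.
move=> u0 h; apply: ge_sup => [|_ [v [v0 vu] <-]]; last exact: h.
by exists (J 0 y); exists 0 => //; split; first exact: vle_refl.
Qed.

Lemma pospart_ge0 y u : 0 <=v u -> 0 <= pospart y u.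
Proof. by move=> u0; rewrite -(pair0l HJ y); apply: le_pospart => //; exact: vle_refl. Qed.

Lemma pospartD y u v : 0 <=v u -> 0 <=v v ->
  pospart y (u + v) = pospart y u + pospart y v.
Proof.
move=> u0 v0; apply/le_anti/andP; split.
  apply: pospart_le => [|w w0 wuv]; first exact: vaddr_ge0.
  have -> : J w y = J (vmeet w u) y + J (w - vmeet w u) y.
    by rewrite -pairDl //; congr (J _ _); vmod.
  apply: lerD; apply: le_pospart; rewrite ?vsub_meet_ge0 ?vmeet_r //.
    exact: vmeet_ge0.
  exact: vsub_meet_le.
rewrite -lerBrDr; apply: pospart_le => // a a0 au; rewrite lerBrDr -lerBrDl.
apply: pospart_le => // b b0 bv; rewrite lerBrDl -pairDl //.
by apply: le_pospart; [exact: vaddr_ge0|exact: vleD].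
Qed.

Lemma pospart0 y : pospart y 0 = 0.
Proof.
by apply: (@addrI _ (pospart y 0)); rewrite -pospartD ?vle_refl // !addr0.
Qed.

Lemma pospart_mono y u v : 0 <=v u -> u <=v v -> pospart y u <= pospart y v.
Proof.
move=> u0 uv; have -> : v = u + (v - u) by vmod.
by rewrite pospartD // ?vsub_ge0 // lerDl pospart_ge0 // vsub_ge0.
Qed.

Lemma pospart_nat y u n : 0 <=v u -> pospart y (n%:R *: u) = n%:R * pospart y u.
Proof.
move=> u0; elim: n => [|n IHn]; first by rewrite scale0r mul0r pospart0.
rewrite -natr1 scalerDl scale1r pospartD // ?IHn ?mulrDl ?mul1r //.
exact: vscale_ge0.
Qed.

Lemma pospart_sum y (n : nat) (f : nat -> X) : (forall i, 0 <=v f i) ->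
  pospart y (\sum_(i < n) f i) = \sum_(i < n) pospart y (f i).
Proof.
move=> f0; elim: n => [|n IHn]; first by rewrite !big_ord0 pospart0.
rewrite !big_ord_recr /= pospartD ?IHn //.
by elim: (n) => [|m IHm]; rewrite ?big_ord0 ?vle_refl // big_ord_recr vaddr_ge0.
Qed.

(** The truncations of [v <= s] by the elements of [S] are directed with
    supremum [v], and on them the functional is at most [M]. *)
Lemma pospart_vsup S e s y (M : R) : S !=set0 -> directed S ->
  (forall a, S a -> 0 <=v a /\ a <=v e) -> is_vsup S s ->
  (forall a, S a -> pospart y a <= M) -> pospart y s <= M.
Proof.
move=> [a Sa] dS bS ss hM; apply: pospart_le => [|v v0 vs].
  by apply: vle_tr (proj1 ss a Sa); case: (bS a Sa).
have h b : (vmeet v @` S) b -> 0 <=v b /\ b <=v v.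
  move=> [u Su <-]; split; last exact: vmeet_l.
  by apply: vmeet_ge0 => //; case: (bS u Su).
apply: (vsup_pair_le _ _ h (vsup_meet ss vs)).
- by exists (vmeet v a); exact: imageP.
- exact: directed_meet.
move=> _ [u Su <-]; apply: le_trans (hM u Su); apply: le_pospart.
  by apply: vmeet_ge0 => //; case: (bS u Su).
exact: vmeet_r.
Qed.

(** Among the elements of [[0, x]] below which the functional of [y] is negative
    there is a largest one, by [directed_sup]. Once it is removed from [x], the
    positive part of the functional is strictly positive on what remains. *)
Lemma strictly_positive_part x : 0 <=v x -> x <> 0 ->
  exists e y, [/\ 0 <=v e, e <=v x, e <> 0 &
    forall u, 0 <=v u -> u <=v e -> pospart y u <= 0 -> u = 0].
Proof.
move=> x0 xn0.
have [y xy] : exists y, 0 < J x y.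
  apply/not_existsP => h; apply: xn0; apply: (pair_inj HJ) => y.
  rewrite (pair0l HJ); apply/le_anti/andP; split.
    by rewrite leNgt; apply/negP/h.
  have := h (- y); rewrite (linN y (pair_linear HJ x)) oppr_gt0 => /negP.
  by rewrite -leNgt.
pose S := [set u | [/\ 0 <=v u, u <=v x & forall v, 0 <=v v -> v <=v u -> J v y <= 0]].
have addS a b v : S a -> S b -> 0 <=v v -> v <=v a + b -> J v y <= 0.
  move=> [a0 _ ha] [b0 _ hb] v0 vab.
  have -> : v = vmeet v a + (v - vmeet v a) by vmod.
  rewrite pairDl // -(addr0 0); apply: lerD.
    by apply: ha; [exact: vmeet_ge0|exact: vmeet_r].
  by apply: hb; [exact: vsub_meet_ge0|exact: vsub_meet_le].
have S0 : S 0.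
  split=> [|//|v v0 v0']; first exact: vle_refl.
  by rewrite (vle_asym v0' v0) (pair0l HJ).
have dS : directed S.
  move=> a b Sa Sb; exists (vjoin a b); split; rewrite ?vjoin_l ?vjoin_r //.
  have [a0 ax _] := Sa; have [b0 bx _] := Sb.
  split=> [||v v0 vab]; first exact: vle_tr (vjoin_l _ _).
    exact: vjoin_lub.
  apply: (addS a b) => //; apply: (vle_tr vab); apply: vjoin_lub.
    by apply: (vle_of1 b0); vmod.
  by apply: (vle_of1 a0); vmod.
have bS a : S a -> 0 <=v a /\ a <=v x by case.
have ne : S !=set0 by exists 0.
have [s [ss _]] := directed_sup HJ ne dS bS.
have s0 : 0 <=v s by exact: proj1 ss 0 S0.
have sx : s <=v x by apply: (proj2 ss) => a; case.
have Ss : S s.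
  split=> // v v0 vs.
  have h b : (vmeet v @` S) b -> 0 <=v b /\ b <=v v.
    move=> [u [u0 _ _] <-]; split; last exact: vmeet_l.
    exact: vmeet_ge0.
  apply: (vsup_pair_le _ _ h (vsup_meet ss vs)).
  - by exists (vmeet v 0); exact: imageP.
  - exact: directed_meet.
  move=> _ [u [u0 _ hu] <-]; apply: hu; [exact: vmeet_ge0|exact: vmeet_r].
exists (x - s), y; split.
- by rewrite vsub_ge0.
- by apply: (vle_of1 s0); vmod.
- move=> /eqP; rewrite subr_eq0 => /eqP e; have [_ _ /(_ x x0)] := Ss.
  by rewrite -e => /(_ (vle_refl _)); rewrite leNgt xy.
move=> u u0 ux hu; have Su : S (s + u).
  split=> [||v v0 vsu]; first exact: vaddr_ge0.
    by apply: (vle_of1 ux); vmod.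
  apply: (addS s u) => //; split=> // [|w w0 wu].
    by apply: (vle_tr ux); apply: (vle_of1 s0); vmod.
  by apply: le_trans hu; exact: le_pospart.
apply: vle_asym => //; have h := proj1 ss _ Su.
by apply: (vle_of1 h); vmod.
Qed.

(** Functionals of the predual are order continuous along sequences. A [v] that
    nearly attains the positive part on [r 0] is compared with its truncations
    [v /\ r m]: the [v - v /\ r m] increase to [v], so the functional becomes
    small on some [v /\ r m], and almost all of the positive part then lives on
    [r 0 - r m]. *)
Lemma pospart_decreasing (r : nat -> X) y (eps : R) : 0 < eps ->
  (forall m n, (m <= n)%N -> r n <=v r m) ->
  (forall m, 0 <=v r m) -> (forall w, (forall m, w <=v r m) -> w <=v 0) ->
  exists m, pospart y (r m) <= eps.
Proof.
move=> eps0 dr r0 infr.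
have [v [v0 vr hv]] : exists v, [/\ 0 <=v v, v <=v r 0%N &
    pospart y (r 0%N) - eps / 2 < J v y].
  apply: contrapT => /forallNP h.
  suff : pospart y (r 0%N) <= pospart y (r 0%N) - eps / 2 by lra.
  apply: pospart_le => // v v0 vr; rewrite leNgt; apply/negP => hv.
  by apply: (h v).
have [m hm] : exists m, J (vmeet v (r m)) y <= eps / 2.
  apply: contrapT => /forallNP h.
  pose S := range (fun m => v - vmeet v (r m)).
  have bS a : S a -> 0 <=v a /\ a <=v v.
    move=> [m _ <-]; split; first exact: vsub_meet_ge0.
    have := vmeet_ge0 v0 (r0 m) => hm; apply: (vle_of1 hm); vmod.
  have dS : directed S.
    have mono m n : (m <= n)%N -> v - vmeet v (r m) <=v v - vmeet v (r n).
      move=> mn; have hm := vmeet_mono (vle_refl v) (dr m n mn).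
      by apply: (vle_of1 hm); vmod.
    move=> _ _ [m _ <-] [n _ <-]; exists (v - vmeet v (r (maxn m n))).
    by split; [exists (maxn m n)|apply: mono; exact: leq_maxl|apply: mono; exact: leq_maxr].
  have ss : is_vsup S v.
    split=> [a /bS[]//|w hw].
    have h0 : v - w <=v 0.
      apply: infr => m; apply: vle_tr (vmeet_r v (r m)).
      have hm : v - vmeet v (r m) <=v w by apply: hw; exists m.
      by apply: (vle_of1 hm); vmod.
    by apply: (vle_of1 h0); vmod.
  suff : J v y <= J v y - eps / 2 by lra.
  apply: (vsup_pair_le _ dS bS ss) => [|_ [m _ <-]].
    by exists (v - vmeet v (r 0%N)); exists 0%N.
  by rewrite pairBl //; have := h m => /negP; rewrite -ltNge; lra.
exists m; have rm := dr 0%N m (leq0n m).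
have e : pospart y (r 0%N) = pospart y (r m) + pospart y (r 0%N - r m).
  by rewrite -pospartD ?vsub_ge0 //; congr pospart; vmod.
have h : J (v - vmeet v (r m)) y <= pospart y (r 0%N - r m).
  apply: le_pospart; first exact: vsub_meet_ge0.
  apply: vsub_meet_le; first by rewrite vsub_ge0.
  by apply: (vle_of1 vr); vmod.
rewrite pairBl // in h; lra.
Qed.

Lemma pair_le_pospart d u y : vabs d <=v u ->
  `|J d y| <= pospart y u + pospart (- y) u.
Proof.
move=> du.
have pu : vpos d <=v u by exact: vle_tr (vpos_le_abs d) du.
have nu : vpos (- d) <=v u by apply: vle_tr (vpos_le_abs _) _; rewrite vabsN.
have h1 := le_pospart y (vpos_ge0 d) pu.
have h2 := le_pospart y (vpos_ge0 (- d)) nu.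
have h3 := le_pospart (- y) (vpos_ge0 d) pu.
have h4 := le_pospart (- y) (vpos_ge0 (- d)) nu.
rewrite !(linN y (pair_linear HJ _)) in h3 h4.
by rewrite -(vposB d) pairBl // ler_norml; apply/andP; split; lra.
Qed.

End positive_part.

(** * Weak-star closed order intervals *)

Lemma half_powers (R : realType) (eps : R) : 0 < eps ->
  exists m, forall k, (m <= k)%N -> 2^-1 ^+ k < eps.
Proof.
move=> eps0; have /cvgrPdist_lt/(_ _ eps0) : (fun k => 2^-1 ^+ k : R) @ \oo --> 0.
  by apply: cvg_expr; rewrite ger0_norm //; lra.
move=> [m _ hm]; exists m => k /hm /=.
by rewrite sub0r normrN ger0_norm ?exprn_ge0.
Qed.

Section order_limit.
Context {R : realType} {X : banachLatticeType R} {Y : normedModType R}.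
Variable J : X -> Y -> R.
Hypothesis HJ : dual_identification J.
Implicit Types (x z a b c d u v w e : X) (S : set X) (y : Y).

Fixpoint joins (a : nat -> X) (m n : nat) : X :=
  if n is n'.+1 then vjoin (joins a m n') (a (m + n)%N) else a m.

Lemma le_joins (a : nat -> X) m n i : (i <= n)%N -> a (m + i)%N <=v joins a m n.
Proof.
elim: n => [|n IHn]; first by rewrite leqn0 => /eqP->; rewrite addn0 vle_refl.
rewrite leq_eqVlt => /orP[/eqP->|]; first exact: vjoin_r.
by rewrite ltnS => /IHn h; exact: vle_tr h (vjoin_l _ _).
Qed.

Lemma joins_le (a : nat -> X) m n w : (forall i, a (m + i)%N <=v w) -> joins a m n <=v w.
Proof.
move=> h; elim: n => [|n IHn] /=; first by have := h 0%N; rewrite addn0.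
exact: vjoin_lub.
Qed.

Lemma joins_mono (a : nat -> X) m n n' : (n <= n')%N -> joins a m n <=v joins a m n'.
Proof.
elim: n' => [|n' IHn]; first by rewrite leqn0 => /eqP->; rewrite vle_refl.
rewrite leq_eqVlt => /orP[/eqP->|]; first exact: vle_refl.
by rewrite ltnS => /IHn h; exact: vle_tr h (vjoin_l _ _).
Qed.

(** The finite joins of the tail exceed [a m] by at most the sum of the
    [|a (k+1) - a k|], and [pospart] passes to their supremum. *)
Lemma tail_sup e y (a : nat -> X) :
  (forall k, 0 <=v a k /\ a k <=v e) ->
  (forall k, pospart J y (vabs (a k.+1 - a k)) <= 2^-1 ^+ k) ->
  exists s : nat -> X, forall m,
    [/\ forall k, (m <= k)%N -> a k <=v s m,
        forall w, (forall k, (m <= k)%N -> a k <=v w) -> s m <=v w &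
        pospart J y (s m - a m) <= 2 * 2^-1 ^+ m].
Proof.
move=> ba ha; suff ex m : exists s, [/\ forall k, (m <= k)%N -> a k <=v s,
        forall w, (forall k, (m <= k)%N -> a k <=v w) -> s <=v w &
        pospart J y (s - a m) <= 2 * 2^-1 ^+ m] by have [s hs] := choice ex; exists s.
pose S := range (joins a m).
have dS : directed S.
  move=> _ _ [i _ <-] [j _ <-]; exists (joins a m (maxn i j)).
  by split; [exists (maxn i j)|apply: joins_mono; exact: leq_maxl|apply: joins_mono; exact: leq_maxr].
have bS z : S z -> 0 <=v z /\ z <=v e.
  move=> [i _ <-]; split; last by apply: joins_le => j; case: (ba (m + j)%N).
  by apply: vle_tr (le_joins a m (leq0n i)); case: (ba (m + 0)%N).
have ne : S !=set0 by exists (joins a m 0); exists 0%N.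
have [s [[ub lb] _]] := directed_sup HJ ne dS bS.
have as_ k : (m <= k)%N -> a k <=v s.
  move=> mk; apply: vle_tr (ub (joins a m (k - m)) _); last by exists (k - m)%N.
  by have := le_joins a m (leqnn (k - m)); rewrite subnKC.
exists s; split=> // [w hw|].
  apply: lb => _ [i _ <-]; apply: joins_le => j; apply: hw; exact: leq_addr.
pose P n := \sum_(i < n) vabs (a (m + i).+1 - a (m + i)%N).
have P0 n : 0 <=v P n.
  by rewrite /P; elim: n => [|n IHn]; rewrite ?big_ord0 ?vle_refl // big_ord_recr vaddr_ge0 ?vabs_ge0.
have aP n : a (m + n)%N <=v a m + P n.
  elim: n => [|n IHn]; first by rewrite addn0 /P big_ord0 addr0 vle_refl.
  rewrite addnS /P big_ord_recr /= -/(P n).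
  by apply: (vle_of2 IHn (vabs_ge (a (m + n).+1 - a (m + n)%N))); vmod.
have jP n : joins a m n - a m <=v P n.
  suff h : joins a m n <=v a m + P n by apply: (vle_of1 h); vmod.
  elim: n => [|n IHn] /=; first by apply: (vle_of1 (P0 0%N)); vmod.
  apply: vjoin_lub; last exact: aP.
  rewrite /P big_ord_recr /= -/(P n).
  by apply: (vle_of2 IHn (vabs_ge0 (a (m + n).+1 - a (m + n)%N))); vmod.
have psiP n : pospart J y (P n) <= 2 * 2^-1 ^+ m.
  rewrite /P (pospart_sum HJ y n (f := fun i => vabs (a (m + i).+1 - a (m + i)%N))); last by move=> i; exact: vabs_ge0.
  have h : \sum_(i < n) pospart J y (vabs (a (m + i).+1 - a (m + i)%N)) <=
           \sum_(i < n) (2^-1 ^+ (m + i) : R) by apply: ler_sum => i _; exact: ha.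
  apply: (le_trans h).
  have -> : \sum_(i < n) (2^-1 ^+ (m + i) : R) = 2 * 2^-1 ^+ m - 2 * 2^-1 ^+ (m + n).
    elim: (n) => [|k IHk]; first by rewrite big_ord0 addn0 subrr.
    rewrite big_ord_recr /= IHk addnS exprS; by field.
  by rewrite lerBlDr lerDl mulr_ge0 // exprn_ge0.
pose S' := (fun z => z - a m) @` S.
have bS' z : S' z -> 0 <=v z /\ z <=v e.
  move=> [u Su <-]; have [am0 _] := ba m; have [_ ue] := bS u Su.
  split; last by apply: (vle_of2 ue am0); vmod.
  rewrite vsub_ge0; case: Su => i _ <-; have := le_joins a m (leq0n i).
  by rewrite addn0.
apply: (pospart_vsup HJ (S := S') (e := e)) => //.
- by exists (joins a m 0 - a m); exists (joins a m 0) => //; exists 0%N.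
- move=> _ _ [u Su <-] [v Sv <-]; have [c [Sc uc vc]] := dS u v Su Sv.
  exists (c - a m); split; first by exists c.
    by apply: (vle_of1 uc); vmod.
  by apply: (vle_of1 vc); vmod.
- split=> [_ [u Su <-]|w hw]; first by apply: (vle_of1 (ub u Su)); vmod.
  have h : s <=v w + a m.
    apply: lb => u Su; have h := hw _ (imageP _ Su).
    by apply: (vle_of1 h); vmod.
  by apply: (vle_of1 h); vmod.
- move=> _ [_ [n _ <-] <-]; apply: le_trans (psiP n); apply: pospart_mono (jP n) => //.
  rewrite vsub_ge0; have := le_joins a m (leq0n n); by rewrite addn0.
Qed.

(** The tail suprema of [a] and of [e - a] enclose the sequence. The width [r] of
    this enclosure has a small [pospart], so it decreases to zero when [pospart]
    is strictly positive. *)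
Lemma order_limit e y (a : nat -> X) : 0 <=v e ->
  (forall u, 0 <=v u -> u <=v e -> pospart J y u <= 0 -> u = 0) ->
  (forall k, 0 <=v a k /\ a k <=v e) ->
  (forall k, pospart J y (vabs (a k.+1 - a k)) <= 2^-1 ^+ k) ->
  exists l (r : nat -> X), [/\ 0 <=v l /\ l <=v e,
    forall k, [/\ 0 <=v r k, r k <=v e & pospart J y (r k) <= 4 * 2^-1 ^+ k],
    forall m n, (m <= n)%N -> r n <=v r m,
    forall w, (forall k, w <=v r k) -> w <=v 0 &
    forall k, vabs (a k - l) <=v r k].
Proof.
move=> e0 sp ba ha.
have [s hs] := tail_sup ba ha.
pose b k := e - a k.
have bb k : 0 <=v b k /\ b k <=v e.
  by have [a0 ae] := ba k; split; rewrite /b; [rewrite vsub_ge0|apply: (vle_of1 a0); vmod].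
have [t ht] : exists s : nat -> X, forall m,
    [/\ forall k, (m <= k)%N -> b k <=v s m,
        forall w, (forall k, (m <= k)%N -> b k <=v w) -> s m <=v w &
        pospart J y (s m - b m) <= 2 * 2^-1 ^+ m].
  apply: tail_sup bb _ => k; have := ha k; rewrite vabs_subC.
  by have -> : a k - a k.+1 = b k.+1 - b k by rewrite /b; vmod.
have as_ m k : (m <= k)%N -> a k <=v s m by case: (hs m) => h _ _; exact: h.
have ia m k : (m <= k)%N -> e - t m <=v a k.
  by case: (ht m) => h _ _ mk; apply: (vle_of1 (h k mk)); rewrite /b; vmod.
have is_ m k : e - t m <=v s k.
  apply: vle_tr (ia m (maxn m k) (leq_maxl _ _)) _; exact: as_ (leq_maxr _ _).
have ts m n : (m <= n)%N -> s n <=v s m.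
  by move=> mn; case: (hs n) => _ h _; apply: h => k nk; apply: as_; exact: leq_trans nk.
have tt m n : (m <= n)%N -> t n <=v t m.
  move=> mn; case: (ht n) => _ h _; apply: h => k nk; case: (ht m) => h' _ _.
  by apply: h'; exact: leq_trans nk.
have se m : s m <=v e by case: (hs m) => _ h _; apply: h => k _; case: (ba k).
have te m : t m <=v e by case: (ht m) => _ h _; apply: h => k _; case: (bb k).
pose S := range (fun m => e - t m).
have [l [[ub lb] _]] : exists l, is_vsup S l /\
    forall (y : Y) (M : R), (forall a, S a -> J a y <= M) -> J l y <= M.
  apply: (directed_sup HJ (e := e)).
  - by exists (e - t 0%N); exists 0%N.
  - move=> _ _ [i _ <-] [j _ <-]; exists (e - t (maxn i j)).
    have hi := tt _ _ (leq_maxl i j); have hj := tt _ _ (leq_maxr i j).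
    split; first by exists (maxn i j).
      by apply: (vle_of1 hi); vmod.
    by apply: (vle_of1 hj); vmod.
  - move=> _ [m _ <-]; split; first by rewrite vsub_ge0.
    have tm0 : 0 <=v t m.
      by apply: vle_tr (proj1 (bb m)) _; case: (ht m) => h _ _; exact: h.
    by apply: (vle_of1 tm0); vmod.
have il m : e - t m <=v l by apply: ub; exists m.
have ls m : l <=v s m by apply: lb => _ [k _ <-]; exact: is_.
pose r m := s m + t m - e.
have psir m : pospart J y (r m) <= 4 * 2^-1 ^+ m.
  have -> : r m = (s m - a m) + (t m - b m) by rewrite /r /b; vmod.
  have [h1 _ h2] := hs m; have [h3 _ h4] := ht m.
  rewrite pospartD ?vsub_ge0 ?h1 ?h3 //; lra.
have r0 m : 0 <=v r m by apply: (vle_of1 (is_ m m)); rewrite /r; vmod.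
have re m : r m <=v e by apply: (vle_of2 (se m) (te m)); rewrite /r; vmod.
exists l, r; split=> //.
- split; last exact: vle_tr (ls 0%N) (se 0%N).
  by apply: vle_tr (il 0%N); rewrite vsub_ge0.
- by move=> m n mn; apply: (vle_of2 (ts m n mn) (tt m n mn)); rewrite /r; vmod.
- move=> w hw; have <- : vpos w = 0; last exact: vpos_ge.
  have wr k : vpos w <=v r k by apply: vpos_lub.
  apply: sp; [exact: vpos_ge0|exact: vle_tr (wr 0%N) (re 0%N)|].
  have h k : pospart J y (vpos w) <= 4 * 2^-1 ^+ k.
    by apply: le_trans (psir k); apply: pospart_mono (wr k) => //; exact: vpos_ge0.
  rewrite leNgt; apply/negP => p0.
  have p4 : 0 < pospart J y (vpos w) / 4 by rewrite divr_gt0.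
  have [k /(_ k (leqnn k)) hk] := half_powers p4.
  by have := h k; lra.
- move=> k; apply: vabs_lub.
    by apply: (vle_of2 (as_ k k (leqnn k)) (il k)); rewrite /r; vmod.
  by apply: (vle_of2 (ls k) (ia k k (leqnn k))); rewrite /r; vmod.
Qed.

End order_limit.

Section closed_interval.
Context {R : realType} {X : banachLatticeType R} {Y : normedModType R}.
Variable J : X -> Y -> R.
Hypothesis HJ : dual_identification J.
Implicit Types (x z a b c d u v w e m : X) (B : set X) (y : Y).

(** In a function space each value of [m] lies between consecutive multiples of
    the value of [d]. Without points: the excess [r = (q - d)^+] stays below
    [(m - (j+1) d)^+] for all [j <= n], because it is disjoint from the
    [(m - j d)^-], and for [j = n] this bound is zero. *)
Lemma grid_distance q m d (n : nat) : 0 <=v d -> 0 <=v m -> m <=v n%:R *: d ->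
  (forall j, (j <= n)%N -> q <=v vabs (m - j%:R *: d)) -> q <=v d.
Proof.
move=> d0 m0 mn hq; pose r := vpos (q - d).
have r0 : 0 <=v r := vpos_ge0 _.
have rle j : (j <= n)%N -> r <=v vpos (m - j.+1%:R *: d).
  elim: j => [|j IHj] jn.
    apply: vpos_mono; have := hq 0%N jn; rewrite scale0r subr0 vabs_id // => h.
    by apply: (vle_of1 h); vmod.
  pose p := m - j.+1%:R *: d.
  have rp : r <=v vpos p := IHj (ltnW jn).
  have dis : vmeet r (vpos (- p)) = 0.
    apply: vle_asym (vmeet_ge0 r0 (vpos_ge0 _)).
    by rewrite -(vmeet_pos_neg p); apply: vmeet_mono rp (vle_refl _).
  have pd : 0 <=v vpos (p - d) := vpos_ge0 _.
  have -> : m - j.+2%:R *: d = p - d.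
    by rewrite /p -[j.+2%:R]natr1 scalerDl scale1r; vmod.
  apply: (vle_disjoint r0 pd (vpos_ge0 (- p)) dis).
  apply: vpos_lub; last exact: vaddr_ge0 pd (vpos_ge0 _).
  have h : vpos p <=v vpos (p - d) + d.
    apply: vpos_lub; last exact: vaddr_ge0.
    by have h := vpos_ge (p - d); apply: (vle_of1 h); vmod.
  have h' := hq j.+1 jn; rewrite -/p vabsE in h'.
  by apply: (vle_of2 h h'); vmod.
have rz : r = 0.
  apply: vle_asym => //; have := rle n (leqnn n); rewrite (@vpos_eq0 _ _ (m - _)) //.
  by apply: (vle_of2 mn d0); rewrite -natr1 scalerDl scale1r; vmod.
have := vpos_ge (q - d); rewrite -/r rz => h.
by apply: (vle_of1 h); vmod.
Qed.

Variable y0 : Y.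
Local Notation psi := (pospart J y0).

(** When [d = e / n] and the elements of [[0, e]] are read as functions with
    values in [[0, 1]], this is close to [n / 2] times the integral of [z^2], a
    strictly convex function; a Banach lattice has no squares. *)
Definition grid_energy d n z : R := \sum_(j < n.+1) psi (vpos (z - j%:R *: d)).

Lemma grid_energy_ge0 d n z : 0 <= grid_energy d n z.
Proof. by apply: sumr_ge0 => j _; apply: pospart_ge0 => //; exact: vpos_ge0. Qed.

(** The convexity defects [G j] bound [|a - b| - |a + b - 2 j d|], so that
    [|a - b| - 2 sum_j G j] is below the distances of [a + b] to the multiples of
    [2 d], to which [grid_distance] applies. *)
Lemma grid_energy_midpoint d n a b : 0 <=v d ->
  0 <=v a -> a <=v n%:R *: d -> 0 <=v b -> b <=v n%:R *: d ->
  psi (vabs (a - b)) <=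
    2 * (grid_energy d n a + grid_energy d n b -
         2 * grid_energy d n (2^-1 *: (a + b))) + 2 * psi d.
Proof.
move=> d0 a0 an b0 bn.
pose al j := a - j%:R *: d; pose be j := b - j%:R *: d.
pose G (j : nat) := vpos (al j) + vpos (be j) - vpos (al j + be j).
have G0 j : 0 <=v G j by rewrite vsub_ge0; exact: vposD.
pose sG := \sum_(j < n.+1) G j.
have sum0 k : 0 <=v \sum_(j < k) G j.
  by elim: k => [|k IHk]; rewrite ?big_ord0 ?vle_refl // big_ord_recr vaddr_ge0.
have Gs j : (j <= n)%N -> G j <=v sG.
  move=> jn; rewrite /sG (bigD1 (Ordinal (jn : (j < n.+1)%N))) //=.
  rewrite -[X in X <=v _]addr0; apply: vleD (vle_refl _) _.
  elim/big_rec: _ => [|i z _ z0]; first exact: vle_refl.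
  exact: vaddr_ge0.
have ab : vabs (a - b) <=v 2%:R *: sG + 2%:R *: d.
  suff h : vabs (a - b) - 2 *: sG <=v 2 *: d by apply: (vle_of1 h); vmod.
  apply: (@grid_distance _ (a + b) _ n).
  - exact: vscale_ge0.
  - exact: vaddr_ge0.
  - by apply: (vle_of2 an bn); vmod.
  move=> j jn.
  have -> : a + b - j%:R *: (2 *: d) = al j + be j by rewrite /al /be; vmod.
  have h1 := Gs j jn; have h2 := vabsD (al j) (- be j).
  have eab : al j - be j = a - b by rewrite /al /be; vmod.
  rewrite eab vabsN in h2.
  have e1 : vabs (al j) + vabs (be j) = 2 *: G j + vabs (al j + be j).
    by rewrite !vabs_pos /G; vmod.
  rewrite e1 in h2.
  have h3 := vleZ (ler0n R 2) h1.
  by apply: (vle_of2 h2 h3); vmod.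
have psiG j : psi (G j) = psi (vpos (al j)) + psi (vpos (be j)) -
    2 * psi (vpos (2^-1 *: (a + b) - j%:R *: d)).
  have -> : 2 * psi (vpos (2^-1 *: (a + b) - j%:R *: d)) = psi (vpos (al j + be j)).
    rewrite -pospart_nat ?vpos_ge0 // -vposZ //; congr psi; congr vpos.
    by rewrite /al /be; vmod.
  have : psi (vpos (al j)) + psi (vpos (be j)) = psi (vpos (al j + be j)) + psi (G j).
    by rewrite -!pospartD ?vpos_ge0 //; congr psi; rewrite /G; vmod.
  lra.
have := pospart_mono HJ y0 (vabs_ge0 (a - b)) ab.
have -> : psi (2%:R *: sG + 2%:R *: d) = 2 * \sum_(j < n.+1) psi (G j) + 2 * psi d.
  have s0 : 0 <=v sG := sum0 n.+1.
  have s2 : 0 <=v 2%:R *: sG by exact: vscale_ge0.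
  have d2 : 0 <=v 2%:R *: d by exact: vscale_ge0.
  rewrite (pospartD HJ y0 s2 d2) (pospart_nat HJ y0 2 s0) (pospart_nat HJ y0 2 d0).
  by rewrite /sG (pospart_sum HJ y0 n.+1 G0).
move=> /le_trans; apply; rewrite lerD2r ler_pM2l //.
rewrite /grid_energy mulr_sumr -big_split -sumrB /=.
by apply: ler_sum => j _; rewrite psiG.
Qed.

Variables (e x : X).
Hypothesis e0 : 0 <=v e.
Hypothesis psi_pos : forall u, 0 <=v u -> u <=v e -> psi u <= 0 -> u = 0.

Definition near_in (F : seq Y) (eps : R) : set X :=
  [set z | (0 <=v z /\ z <=v e) /\ forall y, y \in F -> `|J (z - x) y| <= eps].

(** The last condition says that [x] is in the weak-star closure of [B]. *)
Definition admissible B : Prop :=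
  [/\ forall z, B z -> 0 <=v z /\ z <=v e,
      forall a b, B a -> B b -> B (2^-1 *: (a + b)) &
      forall F (eps : R), 0 < eps -> B `&` near_in F eps !=set0].

Lemma midpoint_interval a b : 0 <=v a /\ a <=v e -> 0 <=v b /\ b <=v e ->
  0 <=v 2^-1 *: (a + b) /\ 2^-1 *: (a + b) <=v e.
Proof.
have h0 : 0 <= 2^-1 :> R by rewrite invr_ge0.
move=> [a0 ae] [b0 be]; split; first exact: vscale_ge0 (vaddr_ge0 a0 b0).
have h1 := vleZ h0 ae; have h2 := vleZ h0 be.
by apply: (vle_of2 h1 h2); vmod.
Qed.

Lemma near_in_midpoint F eps a b : near_in F eps a -> near_in F eps b ->
  near_in F eps (2^-1 *: (a + b)).
Proof.
move=> [ia ha] [ib hb]; split=> [|y yF]; first exact: midpoint_interval.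
have -> : 2^-1 *: (a + b) - x = 2^-1 *: ((a - x) + (b - x)) by vmod.
rewrite pairZl // pairDl // normrM ger0_norm ?invr_ge0 //.
have := ler_normD (J (a - x) y) (J (b - x) y); have := ha y yF; have := hb y yF.
lra.
Qed.

(** The near-minimizers of a uniformly convex function on a convex set have
    small diameter. To keep [x] in the weak-star closure, the relevant minimum
    is that over small weak-star neighbourhoods of [x], in the limit [Q]. *)
Lemma admissible_shrink B (eps : R) : admissible B -> 0 < eps ->
  exists B', [/\ admissible B', B' `<=` B &
    forall a b, B' a -> B' b -> psi (vabs (a - b)) <= eps].
Proof.
move=> [Be Bmid Bnear] eps0.
have pe0 : 0 <= psi e := pospart_ge0 HJ y0 e0.
have [n n0 hn] : exists2 n : nat, (0 < n)%N & 4 * psi e / eps < n%:R.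
  have h0 : 0 <= 4 * psi e / eps by rewrite divr_ge0 ?mulr_ge0 // ltW.
  have := archi_boundP h0; move: (Num.bound _) => n hn.
  by exists n.+1 => //; rewrite -natr1; lra.
have nR : 0 < n%:R :> R by rewrite ltr0n.
pose d := n%:R^-1 *: e.
have d0 : 0 <=v d by apply: vscale_ge0 => //; rewrite invr_ge0 ltW.
have nd : n%:R *: d = e by rewrite /d scalerA divff ?lt0r_neq0 // scale1r.
have psid : 2 * psi d <= eps / 2.
  have : n%:R * psi d = psi e by rewrite -pospart_nat // nd.
  move: hn; rewrite ltr_pdivrMr // => hn h.
  rewrite -(ler_pM2l nR); nra.
pose q := grid_energy d n.
have q0 z : 0 <= q z := grid_energy_ge0 d n z.
have qM z : 0 <=v z /\ z <=v e -> q z <= \sum_(j < n.+1) psi e.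
  move=> [z0 ze]; apply: ler_sum => j _; apply: pospart_mono => //; first exact: vpos_ge0.
  apply: vpos_lub => //; have jd : 0 <=v j%:R *: d by exact: vscale_ge0.
  by apply: (vle_of2 ze jd); vmod.
pose I F del := inf (q @` (B `&` near_in F del)).
pose V := [set I p.1 p.2 | p in [set p : seq Y * R | 0 < p.2]].
have I_le F del z : B z -> near_in F del z -> I F del <= q z.
  move=> Bz nz; apply: ge_inf; last by exists z.
  by exists 0 => _ [w _ <-].
have V_ub : has_ubound V.
  exists (\sum_(j < n.+1) psi e) => _ [[F del] /= del0 <-].
  have [z [Bz nz]] := Bnear F del del0.
  exact: le_trans (I_le F del z Bz nz) (qM z (Be z Bz)).
have V_ne : V !=set0 by exists (I [::] 1); exists ([::], 1) => //=.
(* The defect of near-minimizers is at most [4 eta], which contributes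
   [8 eta = eps / 2] to the diameter; the grid contributes [2 psi d]. *)
pose eta := eps / 16; have eta0 : 0 < eta by rewrite divr_gt0.
have [_ [[F0 del0] /= del00 <-] hQ] := sup_adherent eta0 (conj V_ne V_ub).
pose Q := sup V; rewrite -/Q in hQ.
exists [set z | [/\ B z, near_in F0 del0 z & q z <= Q + eta]].
have mid a b : B a -> B b -> near_in F0 del0 a -> near_in F0 del0 b ->
    [/\ psi (vabs (a - b)) <= 2 * (q a + q b - 2 * q (2^-1 *: (a + b))) + 2 * psi d &
        Q - eta <= q (2^-1 *: (a + b))].
  move=> Ba Bb na nb; have [a0 ae] := Be a Ba; have [b0 be] := Be b Bb; split.
    by apply: grid_energy_midpoint; rewrite ?nd.
  apply: (le_trans (ltW hQ)); apply: I_le; first exact: Bmid.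
  exact: near_in_midpoint.
split=> [|z []//|a b [Ba na qa] [Bb nb qb]]; last first.
  by have [] := mid a b Ba Bb na nb; rewrite /eta in qa qb *; lra.
split=> [z [Bz _ _]|a b [Ba na qa] [Bb nb qb]|F del del1]; first exact: Be.
- split; [exact: Bmid|exact: near_in_midpoint|].
  have [h _] := mid a b Ba Bb na nb.
  have h0 : 0 <= q a + q b - 2 * q (2^-1 *: (a + b)).
    have [a0 ae] := Be a Ba; have [b0 be] := Be b Bb.
    rewrite /q /grid_energy mulr_sumr -big_split -sumrB /=; apply: sumr_ge0 => j _.
    rewrite subr_ge0 -pospart_nat ?vpos_ge0 // -pospartD ?vpos_ge0 // -vposZ //.
    apply: pospart_mono => //; first exact: vpos_ge0.
    have -> : 2 *: (2^-1 *: (a + b) - j%:R *: d) = (a - j%:R *: d) + (b - j%:R *: d).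
      by vmod.
    exact: vposD.
  lra.
have [z [Bz nz] qz] : exists2 z, (B `&` near_in (F ++ F0) (Num.min del del0)) z & q z < Q + eta.
  have m0 : 0 < Num.min del del0 by rewrite lt_min del1.
  have [z0 z0B] := Bnear (F ++ F0) _ m0.
  have ne : q @` (B `&` near_in (F ++ F0) (Num.min del del0)) !=set0 by exists (q z0); exists z0.
  have lb : has_lbound (q @` (B `&` near_in (F ++ F0) (Num.min del del0))).
    by exists 0 => _ [w _ <-].
  have [_ [z zB <-] hz] := inf_adherent eta0 (conj ne lb).
  exists z => //; apply: (lt_le_trans hz); rewrite lerD2r.
  by apply: sup_ubound => //; exists (F ++ F0, Num.min del del0).
have [iz hz] := nz.
exists z; split; first split=> //.
- split=> // y yF; have := hz y; rewrite mem_cat yF orbT => /(_ isT) /le_trans; apply.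
  by rewrite ge_min lexx orbT.
- exact: ltW.
- split=> // y yF; have := hz y; rewrite mem_cat yF => /(_ isT) /le_trans; apply.
  by rewrite ge_min lexx.
Qed.

(** Nested midpoint convex sets with [x] in their weak-star closures and with
    shrinking diameters are obtained from [admissible_shrink]. All sequences
    taken from these sets have the same order limit in [[0, e]], and it is [x],
    because the functionals of the predual are order continuous. *)
Theorem interval_wstar_closed :
  (forall F (eps : R), 0 < eps -> near_in F eps !=set0) -> 0 <=v x /\ x <=v e.
Proof.
move=> hx.
pose T := {B | admissible B}.
have step (p : T * nat) : exists B' : T, sval B' `<=` sval p.1 /\
    forall a b, sval B' a -> sval B' b -> psi (vabs (a - b)) <= 2^-1 ^+ p.2.
  case: p => [[B aB] k] /=.
  have [|B' [aB' sub dia]] := @admissible_shrink B (2^-1 ^+ k) aB; first exact: exprn_gt0.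
  by exists (exist _ B' aB').
have [f hf] := choice step.
have adm0 : admissible [set z | 0 <=v z /\ z <=v e].
  split=> // [a b|F eps eps0]; first exact: midpoint_interval.
  by have [z nz] := hx F eps eps0; exists z; split=> //; case: nz.
pose Bs := fix Bs (k : nat) : T := if k is k'.+1 then f (Bs k', k') else exist _ _ adm0.
have sub k : sval (Bs k.+1) `<=` sval (Bs k) := proj1 (hf (Bs k, k)).
have dia k a b : sval (Bs k.+1) a -> sval (Bs k.+1) b -> psi (vabs (a - b)) <= 2^-1 ^+ k.
  exact: (proj2 (hf (Bs k, k))).
have limit (s : nat -> X) : (forall k, sval (Bs k.+1) (s k)) ->
    exists l (r : nat -> X), [/\ 0 <=v l /\ l <=v e,
    forall k, [/\ 0 <=v r k, r k <=v e & psi (r k) <= 4 * 2^-1 ^+ k],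
    forall m n : nat, (m <= n)%N -> r n <=v r m,
    forall w, (forall k, w <=v r k) -> w <=v 0 &
    forall k, vabs (s k - l) <=v r k].
  move=> hs; apply: order_limit => // [k|k].
    by case: (svalP (Bs k.+1)) => h _ _; exact: h.
  by apply: dia => //; exact/sub/hs.
have exz (k : nat) (F : seq Y) : exists z, sval (Bs k.+1) z /\ near_in F (2^-1 ^+ k) z.
  by case: (svalP (Bs k.+1)) => _ _ /(_ F (2^-1 ^+ k)) []; [exact: exprn_gt0|move=> z []; exists z].
have [z hz] := choice (fun k => exz k [::]).
have [l [r [il hr _ _ zr]]] := limit z (fun k => proj1 (hz k)).
suff -> : x = l by [].
apply: (pair_inj HJ) => y.
have [s hs] := choice (fun k => exz k [:: y]).
have [l' [r' [il' hr' dr' ir' sr']]] := limit s (fun k => proj1 (hs k)).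
(* The limit does not depend on the sequence, so a sequence adapted to [y] can
   be compared with [x] at [y]. *)
have ll' : l = l'.
  apply/eqP; rewrite -subr_eq0 -normr_le0 -vabs_norm.
  suff -> : vabs (l - l') = 0 by rewrite normr0.
  have [l0 le] := il; have [l0' le'] := il'.
  apply: psi_pos; first exact: vabs_ge0.
    by apply: vabs_lub; [apply: (vle_of2 le l0')|apply: (vle_of2 le' l0)]; vmod.
  have h k : psi (vabs (l - l')) <= 9 * 2^-1 ^+ k.
    have hk : vabs (l - l') <=v r k + vabs (z k - s k) + r' k.
      have h1 := vabsD (z k - s k - (z k - l)) (s k - l').
      have e1 : z k - s k - (z k - l) + (s k - l') = l - l' by vmod.
      have h2 := vabsD (z k - s k) (- (z k - l)); rewrite vabsN in h2.
      rewrite e1 in h1.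
      have h3 : vabs (l - l') <=v vabs (z k - s k) + vabs (z k - l) + vabs (s k - l').
        by apply: (vle_of2 h1 h2); vmod.
      by apply: (vle_of3 h3 (zr k) (sr' k)); vmod.
    apply: (le_trans (pospart_mono HJ y0 (vabs_ge0 _) hk)).
    have [r0 _ pr] := hr k; have [r0' _ pr'] := hr' k.
    have zs := dia k _ _ (proj1 (hz k)) (proj1 (hs k)).
    rewrite !pospartD ?vabs_ge0 ?vaddr_ge0 ?vabs_ge0 //; lra.
  rewrite leNgt; apply/negP => p0.
  have p9 : 0 < psi (vabs (l - l')) / 9 by rewrite divr_gt0.
  have [k /(_ k (leqnn k)) hk] := half_powers p9.
  by have := h k; lra.
rewrite ll'; apply/eqP; rewrite -subr_eq0 -normr_le0; apply/ler_addgt0Pr => eps eps0.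
rewrite add0r -pairBl //.
have eps4 : 0 < eps / 4 by rewrite divr_gt0.
have [m1 hm1] := pospart_decreasing HJ y eps4 dr' (fun k => let: And3 h _ _ := hr' k in h) ir'.
have [m2 hm2] := pospart_decreasing HJ (- y) eps4 dr' (fun k => let: And3 h _ _ := hr' k in h) ir'.
have [m3 hm3] := half_powers eps4.
pose k := maxn m1 (maxn m2 m3).
have k1 : (m1 <= k)%N by exact: leq_maxl.
have k2 : (m2 <= k)%N by rewrite /k !leq_max leqnn orbT.
have k3 : (m3 <= k)%N by rewrite /k !leq_max leqnn !orbT.
have hp yy (i : nat) : (i <= k)%N -> pospart J yy (r' k) <= pospart J yy (r' i).
  by move=> mk; apply: pospart_mono (dr' _ _ mk) => //; case: (hr' k).
have h1 := pair_le_pospart HJ y (sr' k).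
have [_ h2] := proj2 (hs k); have {}h2 := h2 y (mem_head _ _).
have -> : x - l' = (s k - l') - (s k - x) by vmod.
rewrite pairBl //; apply: (le_trans (ler_normB _ _)).
have := hp y m1 k1; have := hp (- y) m2 k2; have := hm3 k k3; lra.
Qed.

End closed_interval.

(** * Essential norms and weak-star continuity *)

Section almost_wstar.
Context {R : realType} {X Y : normedModType R} (J : X -> Y -> R).
Hypothesis HJ : dual_identification J.
Implicit Types (S T : X -> X) (x z : X) (y : Y).

(** Weak-star to norm continuity on bounded sets, up to a defect [c] per unit of
    radius. The essential norm of the preadjoint bounds the least such [c]. *)
Definition almost_wstar_continuous T (c : R) : Prop :=
  forall (U : set_system X) x (r : R), UltraFilter U -> wstar_cvg J U x ->
    U [set z | `|z - x| <= r] ->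
    forall eta : R, 0 < eta -> U [set z | `|T z - T x| <= c * r + eta].

Lemma wstar_cvg_finite (U : set_system X) x (D : seq Y) (del : R) :
  ProperFilter U -> wstar_cvg J U x -> 0 < del ->
  U [set z | forall y, y \in D -> `|J (z - x) y| <= del].
Proof.
move=> PU Ux del0; elim: D => [|a D IHD]; first by apply: filterS filterT.
have h : U [set z | `|J (z - x) a| <= del].
  have /cvgrPdist_le/(_ _ del0) := Ux a; apply: filterS => z /=.
  by rewrite pairBl // distrC.
apply: filterS2 h IHD => z /= h1 h2 y; rewrite inE => /orP[/eqP->//|]; exact: h2.
Qed.

Lemma almost_wstar0 : almost_wstar_continuous (fun=> 0) 0.
Proof.
move=> U x r UU _ _ eta eta0; apply: filterS filterT => z _ /=.
by rewrite subrr normr0 mul0r add0r ltW.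
Qed.

Lemma almost_wstarD S T c d :
  almost_wstar_continuous S c -> almost_wstar_continuous T d ->
  almost_wstar_continuous (fun x => S x + T x) (c + d).
Proof.
move=> hS hT U x r UU Ux Ur eta eta0; have eta2 : 0 < eta / 2 by rewrite divr_gt0.
apply: filterS2 (hS U x r UU Ux Ur _ eta2) (hT U x r UU Ux Ur _ eta2) => z /= h1 h2.
have -> : S z + T z - (S x + T x) = (S z - S x) + (T z - T x) by vmod.
by apply: (le_trans (ler_normD _ _)); lra.
Qed.

Lemma almost_wstarZ (t : R) T c : 0 < t -> almost_wstar_continuous T c ->
  almost_wstar_continuous (fun x => t *: T x) (t * c).
Proof.
move=> t0 hT U x r UU Ux Ur eta eta0; have eta' : 0 < eta / t by rewrite divr_gt0.
apply: filterS (hT U x r UU Ux Ur _ eta') => z /= h.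
rewrite -scalerBr normrZ gtr0_norm //.
have -> : t * c * r + eta = t * (c * r + eta / t) by field; rewrite lt0r_neq0.
by rewrite ler_pM2l.
Qed.

Lemma bounded_opB (V W : normedModType R) (S T : V -> W) :
  bounded_op S -> bounded_op T -> bounded_op (S \- T).
Proof.
move=> bS bT; have lS := proj1 bS; have lT := proj1 bT.
apply: (@bounded_op_of_bound _ _ _ _ (opnorm S + opnorm T)) => [t u v|u] /=.
  by rewrite lS lT; vmod.
apply: (le_trans (ler_normB _ _)); rewrite mulrDl.
by apply: lerD; exact: opnorm_bound.
Qed.

(** [J (T z - T x)] is [J (z - x)] evaluated on the image of the unit ball under
    [S]. Up to the norm of [S - K], this image is totally bounded, and weak-star
    convergence is uniform on finitely many centres. *)
Lemma adjoint_almost_wstar T (S K : Y -> Y) :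
  adjoint_of J T S -> compact_op K ->
  almost_wstar_continuous T (opnorm (S \- K)).
Proof.
move=> [bS hTS] [bK pK] U x r UU Ux Ur eta eta0.
have PU : ProperFilter U by exact: ultra_proper.
have r0 : 0 <= r.
  by have [z /= zr] := filter_ex Ur; exact: le_trans (normr_ge0 _) zr.
pose del := eta / (2 * (r + 1)).
have r1 : 0 < r + 1 by lra.
have del0 : 0 < del by rewrite divr_gt0 // mulr_gt0.
have [D hD] : exists D : seq Y, forall y, `|y| <= 1 ->
    exists2 a, a \in D & `|K y - a| <= del.
  rewrite precompactE compact_cover in pK.
  have [||D _ hD] := pK Y setT (fun a => ball a del).
  - by move=> a _; exact: ball_open.
  - by move=> b _; exists b => //; exact: ballxx.
  exists (finmap.enum_fset D) => y y1.
  have [|a aD] := hD (K y); first by apply: subset_closure; exists y.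
  by rewrite -ball_normE /= distrC => /ltW h; exists a.
have eta2 : 0 < eta / 2 by rewrite divr_gt0.
apply: filterS2 Ur (wstar_cvg_finite D PU Ux eta2) => z /= zr hz.
apply: (norm_le_pair HJ) => y y1.
have [a aD Ka] := hD y y1.
rewrite pairBl // !hTS -pairBl //.
have lJ := pair_linear HJ (z - x).
have -> : S y = (S \- K) y + (K y - a) + a by rewrite /=; vmod.
rewrite (linD _ a lJ) (linD ((S \- K) y) _ lJ); apply: (le_trans (ler_normD _ _)).
apply: (@le_trans _ _ (opnorm (S \- K) * r + del * r + eta / 2)).
  apply: lerD; last exact: hz.
  apply: (le_trans (ler_normD _ _)); apply: lerD.
    apply: (le_trans (pair_bound HJ _ _)); rewrite mulrC; apply: ler_pM => //.
    have bSK := bounded_opB bS bK.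
    apply: (le_trans (opnorm_bound y bSK)).
    by rewrite -[leRHS]mulr1 ler_wpM2l // opnorm_ge0.
  by apply: (le_trans (pair_bound HJ _ _)); rewrite mulrC; apply: ler_pM.
have : del * r <= eta / 2.
  rewrite /del; have -> : eta / (2 * (r + 1)) * r = (eta / 2) * (r / (r + 1)).
    by field; rewrite lt0r_neq0.
  by rewrite -[leRHS]mulr1 ler_pM2l // ler_pdivrMr // mul1r lerDl.
lra.
Qed.

End almost_wstar.

Lemma compact_op0 (R : realType) (V : normedModType R) : compact_op (fun _ : V => 0 : V).
Proof.
split.
  apply: (@bounded_op_of_bound _ _ _ _ 0) => [t u v|u]; first by rewrite scaler0 addr0.
  by rewrite normr0 mul0r.
have -> : (fun _ : V => 0 : V) @` [set x | `|x| <= 1] = [set 0].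
  apply/seteqP; split=> [_ [x _ <-]//|_ ->]; exists 0 => //=; by rewrite normr0.
rewrite precompact_closed; first exact: compact_set1.
exact: (accessible_closed_set1 (hausdorff_accessible (@norm_hausdorff _ _))).
Qed.

(** * Separation from the operators *)

Section cone.
Context {R : realType} {X : banachLatticeType R} (C : set (X -> X)).
Hypothesis C_convex : @convex_set R (X -> X) C.
Hypothesis C_linear : forall T, C T -> linear T.
Hypothesis C_positive : forall T, C T -> positive_op T.
Implicit Types (S T : X -> X) (x z : X) (t : R).

(** Convexity of [C] makes this a convex cone. The zero operator is added so that
    [push_cost] below is at most the norm. *)
Definition in_cone S : Prop :=
  S = (fun=> 0) \/ exists t T, [/\ 0 < t, C T & S = (fun x => t *: T x)].

Lemma in_cone_linear S : in_cone S -> linear S.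
Proof.
move=> [->|[t [T [t0 CT ->]]]] a u v; first by rewrite scaler0 addr0.
by rewrite (C_linear CT); vmod.
Qed.

Lemma in_cone_positive S : in_cone S -> positive_op S.
Proof.
move=> [->|[t [T [t0 CT ->]]]] x x0; first exact: vle_refl.
by apply: vscale_ge0; [exact: ltW|exact: C_positive].
Qed.

Lemma in_coneZ S t : 0 < t -> in_cone S -> in_cone (fun x => t *: S x).
Proof.
move=> t0 [->|[r [T [r0 CT ->]]]]; first by left; apply/funext => x; rewrite scaler0.
by right; exists (t * r), T; split=> //; [exact: mulr_gt0|apply/funext => x; rewrite scalerA].
Qed.

Lemma in_coneD S T : in_cone S -> in_cone T -> in_cone (fun x => S x + T x).
Proof.
move=> [->|[s [S' [s0 CS ->]]]].
  by move=> CT; have -> : (fun x => 0 + T x) = T by apply/funext => x; rewrite add0r.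
move=> [->|[t [T' [t0 CT ->]]]].
  by right; exists s, S'; split=> //; apply/funext => x; rewrite addr0.
have st : 0 < s + t by exact: addr_gt0.
have l0 : 0 <= s / (s + t) by rewrite divr_ge0 // ltW.
have l1 : s / (s + t) <= 1 by rewrite ler_pdivrMr // mul1r lerDl ltW.
pose l : {i01 R} := Itv01 l0 l1.
have := C_convex l (mem_set CS) (mem_set CT) => /set_mem h.
right; exists (s + t); eexists; split; [exact: st|exact: h|].
apply/funext => x.
change (s *: S' x + t *: T' x =
  (s + t) *: ((s / (s + t)) *: S' x + (1 - s / (s + t)) *: T' x)).
rewrite scalerDr !scalerA; congr (_ *: _ + _ *: _); by field; rewrite lt0r_neq0.
Qed.

End cone.

Section dichotomy.
Context {R : realType} {X : banachLatticeType R} {Y : completeNormedModType R}.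
Variables (J : X -> Y -> R) (C : set (X -> X)).
Hypothesis HJ : dual_identification J.
Hypothesis C_convex : @convex_set R (X -> X) C.
Hypothesis C_positive : forall T, C T -> positive_op T.
Implicit Types (S T : X -> X) (x y z e : X).

Let coneD := in_coneD C_convex.

(** The price of lifting [x] above [y]: an operator of the cone does it up to an
    error in norm, and its lack of weak-star continuity is charged. *)
Definition push_costs x y : set R :=
  [set r | exists S c, [/\ in_cone C S, 0 <= c, almost_wstar_continuous J S c &
    r = c + `|vpos (y - S x)|]].

Definition push_cost x y : R := inf (push_costs x y).

Lemma push_costs_ge0 x y r : push_costs x y r -> 0 <= r.
Proof. by move=> [S [c [_ c0 _ ->]]]; rewrite addr_ge0. Qed.

Lemma push_costs_norm x y : push_costs x y `|vpos y|.
Proof.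
exists (fun=> 0), 0; split=> //; [by left|exact: almost_wstar0|].
by rewrite subr0 add0r.
Qed.

Lemma push_cost_le x y r : push_costs x y r -> push_cost x y <= r.
Proof. by apply: ge_inf; exists 0 => s; exact: push_costs_ge0. Qed.

Lemma le_push_cost x y r :
  (forall s, push_costs x y s -> r <= s) -> r <= push_cost x y.
Proof. by move=> h; apply: lb_le_inf => //; exists `|vpos y|; exact: push_costs_norm. Qed.

Lemma sublinear_push_cost x : sublinear (push_cost x).
Proof.
apply: sublinearP => [y z||t y t0].
- rewrite -lerBlDr; apply: le_push_cost => _ [S [c [CS c0 hS ->]]].
  rewrite lerBlDr -lerBlDl; apply: le_push_cost => _ [T [d [CT d0 hT ->]]].
  rewrite lerBlDl; apply: (le_trans (push_cost_le _)).
    exists (fun x => S x + T x), (c + d); split; last reflexivity.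
    + exact: coneD.
    + exact: addr_ge0.
    + exact: almost_wstarD.
  have -> : y + z - (S x + T x) = (y - S x) + (z - T x) by vmod.
  by have := proj1 (@sublinear_norm_pos R X) (y - S x) (z - T x); lra.
- apply/le_anti/andP; split; last by apply: le_push_cost => r; exact: push_costs_ge0.
  by apply: push_cost_le; have := push_costs_norm x 0; rewrite vpos0 normr0.
- rewrite -ler_pdivrMl //; apply: le_push_cost => _ [S [c [CS c0 hS ->]]].
  rewrite ler_pdivrMl //; apply: push_cost_le.
  exists (fun x => t *: S x), (t * c); split.
  + exact: in_coneZ.
  + by rewrite mulr_ge0 // ltW.
  + exact: almost_wstarZ.
  + by rewrite -scalerBr vposZ ?ltW // normrZ gtr0_norm // mulrDr.
Qed.

Hypothesis C_adjoint : forall T, C T -> is_adjoint J T.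

(** A functional below the cost is at most [c] on [T x], since [T] lifts [x] above
    [T x] without error. *)
Lemma separating_functional x e : 0 < push_cost x e ->
  exists f : X -> R, [/\ bounded_op f /\ positive_functional f, f <> (fun=> 0) &
    forall T, C T -> f (T x) <= essnorm (preadjoint J T)].
Proof.
move=> pe; have [f [lf fp fe]] := hahn_banach e (sublinear_push_cost x).
have fle y : f y <= `|vpos y|.
  exact: le_trans (fp y) (push_cost_le (push_costs_norm x y)).
exists f; split.
- split.
    apply: (@bounded_op_of_bound _ _ _ _ 1) => // y; rewrite mul1r ler_norml.
    have := le_trans (fle y) (vnorm_pos y).
    have := le_trans (fle (- y)) (vnorm_pos (- y)).
    by rewrite normrN (linN _ lf); lra.
  move=> y y0; have := fle (- y).
  by rewrite (linN _ lf) (@vpos_eq0 _ _ (- y)) ?normr0; [lra|rewrite -(oppr0 X) vleN].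
- by move=> f0; move: pe; rewrite -fe f0 ltxx.
move=> T CT; apply: lb_le_inf.
  by exists (opnorm (preadjoint J T \- (fun=> 0))); exists (fun=> 0) => //; exact: compact_op0.
move=> _ [K /= cK <-].
have hT : adjoint_of J T (preadjoint J T) by exact: xgetPex (C_adjoint CT).
apply: (le_trans (fp _)); apply: push_cost_le.
exists T, (opnorm (preadjoint J T \- K)); split.
- by right; exists 1, T; split=> //; apply/funext => y; rewrite scale1r.
- by apply: opnorm_ge0; apply: bounded_opB; [case: hT|case: cK].
- exact: (adjoint_almost_wstar HJ).
- by rewrite subrr vpos0 normr0 addr0.
Qed.

Lemma push_of_cost0 x e (eps : R) : push_cost x e <= 0 -> 0 < eps ->
  exists S c, [/\ in_cone C S, almost_wstar_continuous J S c, c <= eps &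
    `|vpos (e - S x)| <= eps].
Proof.
move=> pe eps0.
have [r [S [c [CS c0 hS ->]]] h] : exists2 r, push_costs x e r & r < eps.
  apply: contrapT => h; suff : eps <= push_cost x e by lra.
  by apply: le_push_cost => r pr; rewrite leNgt; apply/negP => re; apply: h; exists r.
exists S, c; have := normr_ge0 (vpos (e - S x)); split=> //; lra.
Qed.

(** Otherwise the sets [G S] of the vectors on which [S] fails would be
    nonempty, and they are directed because positive operators add up. A
    weak-star cluster point [x] of these sets is still positive and nonzero, so
    some [S] with little lack of continuity lifts [x] almost above [e]; it does
    the same for the vectors close to [x], some of which are in [G S]. *)
Lemma uniform_push (y0 : Y) e (eps : R) :
  0 <=v e -> 0 < eps -> eps < `|e| ->
  (forall u, 0 <=v u -> u <=v e -> pospart J y0 u <= 0 -> u = 0) ->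
  (forall x, 0 <=v x -> x <> 0 -> push_cost x e <= 0) ->
  exists S, in_cone C S /\ forall z, 0 <=v z -> z <=v e -> `|e - z| <= eps ->
    `|vpos (e - S z)| <= eps.
Proof.
move=> e0 eps0 epse psi_pos cost0; apply: contrapT => noS.
pose G S := [set z : X | [/\ 0 <=v z, z <=v e, `|e - z| <= eps & eps < `|vpos (e - S z)|]].
have GDl S T : in_cone C S -> in_cone C T -> G (fun z => S z + T z) `<=` G S.
  move=> CS CT z [z0 ze ez h]; split=> //; apply: (lt_le_trans h).
  apply: vnorm_mono; [exact: vpos_ge0|apply: vpos_mono].
  have Tz : 0 <=v T z by exact: (in_cone_positive C_positive CT).
  by apply: (vle_of1 Tz); vmod.
have FG : ProperFilter (filter_from (in_cone C) G).
  apply: filter_from_proper.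
    apply: filter_from_filter; first by exists (fun=> 0); left.
    move=> S T CS CT; exists (fun z => S z + T z); first exact: coneD.
    move=> z Gz; split; first exact: GDl Gz.
    apply: (GDl T S) => //; have -> : (fun z => T z + S z) = (fun z => S z + T z) => //.
    by apply/funext => w; rewrite addrC.
  move=> S CS; apply: contrapT => nG; apply: noS; exists S; split=> // z z0 ze ez.
  by rewrite leNgt; apply/negP => h; apply: nG; exists z; split.
have [U [UU GU]] := ultraFilterLemma FG.
have PU : ProperFilter U by exact: ultra_proper.
have UG S : in_cone C S -> U (G S) by move=> CS; apply: GU; exists S.
have UG0 := UG _ (or_introl (erefl (fun=> 0))).
have [x Ux] : exists x, wstar_cvg J U x.
  apply: (wstar_compact HJ (M := `|e|)); apply: filterS UG0 => z [z0 ze _ _] /=.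
  exact: vnorm_mono.
have [x_ge0 xe] : 0 <=v x /\ x <=v e.
  apply: (interval_wstar_closed HJ e0 psi_pos) => F del del0.
  have [z [[z0 ze _ _] hz]] := filter_ex (filterI UG0 (wstar_cvg_finite HJ F PU Ux del0)).
  by exists z.
have ex : `|e - x| <= eps.
  rewrite -normrN opprB addrC; apply: (wstar_norm_le HJ PU Ux).
  by apply: filterS UG0 => z [_ _ h _] /=; rewrite addrC -normrN opprB.
have xn0 : x <> 0 by move=> x0; move: ex; rewrite x0 subr0; lra.
(* For [z] and [x] of norm at most [|e|], the total error is at most
   [d + 2 |e| d + eps / 4], which is below [eps]. *)
have e1 : 0 < 1 + `|e| by rewrite ltr_pwDl.
pose d := eps / (4 * (1 + `|e|)).
have d0 : 0 < d by rewrite divr_gt0 // mulr_gt0.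
have de : d * (1 + `|e|) = eps / 4 by rewrite /d; field; rewrite lt0r_neq0.
have [S [c [CS hS cd Sx]]] := push_of_cost0 (cost0 x x_ge0 xn0) d0.
have Ur : U [set z | `|z - x| <= 2 * `|e|].
  apply: filterS UG0 => z [z0 ze _ _] /=; apply: (le_trans (ler_normB _ _)).
  by have := vnorm_mono z0 ze; have := vnorm_mono x_ge0 xe; lra.
have eps4 : 0 < eps / 4 by rewrite divr_gt0.
have [z [[z0 ze ez h] /= Sz]] := filter_ex (filterI (UG S CS) (hS U x _ UU Ux Ur _ eps4)).
suff : `|vpos (e - S z)| <= eps by lra.
have := proj1 (@sublinear_norm_pos R X) (e - S x) (S x - S z).
have -> : e - S x + (S x - S z) = e - S z by vmod.
have := vnorm_pos (S x - S z); rewrite -(normrN (S x - S z)) opprB.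
have : c * (2 * `|e|) <= d * (2 * `|e|) by rewrite ler_wpM2r // mulr_ge0.
have : 0 <= `|e| by []; nra.
Qed.

End dichotomy.

(** * Iteration *)

Section iteration.
Context {R : realType} {X : banachLatticeType R}.
Implicit Types (T S : X -> X) (x z e : X).

Lemma geometric_growth_not_quasinilpotent T x (delta t : R) :
  0 < delta -> 0 < t -> (forall n, delta <= t ^+ n * `|iter n T x|) ->
  ~ locally_quasinilpotent T x.
Proof.
move=> delta0 t0 h; rewrite /locally_quasinilpotent /limn_esup /limf_esup => lq.
(* The minimum with one gives [(k t)^n <= delta] for all [n > 0]. *)
pose k := Num.min delta 1 / t.
have m0 : 0 < Num.min delta 1 by rewrite lt_min delta0 ltr01.
have k0 : 0 < k by rewrite divr_gt0.
suff : (k%:E <= 0)%E by rewrite lee_fin leNgt k0.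
rewrite -lq; apply: le_ereal_inf_tmp => _ [V [N _ NV] <-].
have VN : V N.+1 by apply: NV => /=; exact: leqnSn.
apply: le_trans (ereal_sup_ubound _); last by exists N.+1; [exact: VN|reflexivity].
rewrite lee_fin.
have -> : k = (k ^+ N.+1) `^ (N.+1%:R^-1).
  by rewrite -powR_mulrn ?ltW // -powRrM mulfV ?pnatr_eq0 // powRr1 // ltW.
have tn0 : 0 < t ^+ N.+1 by exact: exprn_gt0.
apply: ge0_ler_powR; rewrite ?nnegrE ?invr_ge0 ?exprn_ge0 ?(ltW k0) ?normr_ge0 ?ler0n //.
rewrite /k expr_div_n ler_pdivrMr // mulrC; apply: le_trans (h N.+1).
have m1 : Num.min delta 1 <= 1 by rewrite ge_min lexx orbT.
apply: (@le_trans _ _ (Num.min delta 1)); last by rewrite ge_min lexx.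
by rewrite exprS -[leRHS]mulr1 ler_pM2l // exprn_ile1 // ltW.
Qed.

(** Truncating at [e] after each application of [S] keeps the iterates near
    [e], and they lie below those of [x]. *)
Lemma push_iter_lower S x e (eps : R) : linear S -> positive_op S ->
  0 <=v e -> e <=v x -> 0 <= eps ->
  (forall z, 0 <=v z -> z <=v e -> `|e - z| <= eps -> `|vpos (e - S z)| <= eps) ->
  forall n, `|e| - eps <= `|iter n S x|.
Proof.
move=> lS S0 e0 ex eps0 hS n.
have Smono u v : u <=v v -> S u <=v S v.
  by move=> uv; rewrite -vsub_ge0 -(linB _ _ lS); apply: S0; rewrite vsub_ge0.
suff [z [z0 ze zx ez]] : exists z, [/\ 0 <=v z, z <=v e, z <=v iter n S x & `|e - z| <= eps].
  apply: (@le_trans _ _ `|z|); last exact: vnorm_mono.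
  have := ler_normD (e - z) z; rewrite subrK; lra.
elim: n => [|n [z [z0 ze zx ez]]].
  by exists e; split=> //; [exact: vle_refl|rewrite subrr normr0].
exists (vmeet e (S z)); split.
- by apply: vmeet_ge0 => //; exact: S0.
- exact: vmeet_l.
- by apply: vle_tr (vmeet_r _ _) _; exact: Smono.
- by rewrite vsub_meet; exact: hS.
Qed.

Lemma iter_scale T (t : R) x n : linear T ->
  iter n (fun x => t *: T x) x = t ^+ n *: iter n T x.
Proof.
move=> lT; elim: n => [|n IHn]; first by rewrite scale1r.
by rewrite !iterS IHn (linZ _ _ lT) scalerA exprS.
Qed.

End iteration.

Theorem theorem5 (R : realType) (Y : completeNormedModType R)
    (X : banachLatticeType R) (J : X -> Y -> R)
    (HJ : dual_identification J)
    (C : set (X -> X))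
    (C_convex : @convex_set R (X -> X) C)
    (C_bounded : forall T, C T -> bounded_op T)
    (C_positive : forall T, C T -> positive_op T)
    (C_adjoint : forall T, C T -> is_adjoint J T)
    (x0 : X) (x0_ge0 : 0 <=v x0) (x0_neq0 : x0 <> 0)
    (C_quasinilpotent : forall T, C T -> locally_quasinilpotent T x0) :
  exists x : X, exists f : X -> R,
    [/\ 0 <=v x /\ x <> 0,
        bounded_op f /\ positive_functional f,
        f <> (fun=> 0)
      & forall T, C T -> f (T x) <= essnorm (preadjoint J T)].
Proof.
have C_linear T : C T -> linear T by case/C_bounded.
have [e [y0 [e0 ex en0 psi_pos]]] := strictly_positive_part HJ x0_ge0 x0_neq0.
apply: contrapT => no_xf.
have cost0 x : 0 <=v x -> x <> 0 -> push_cost J C x e <= 0.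
  move=> x_ge0 xn0; rewrite leNgt; apply/negP => cost_gt0; apply: no_xf.
  have [f [? ? ?]] := separating_functional HJ C_convex C_adjoint cost_gt0.
  by exists x, f.
have ne : 0 < `|e| by rewrite normr_gt0; apply/eqP.
pose eps := `|e| / 2.
have eps0 : 0 < eps by rewrite /eps; lra.
have epse : eps < `|e| by rewrite /eps; lra.
have [S [CS hS]] :=
  uniform_push HJ C_convex C_positive e0 eps0 epse psi_pos cost0.
have := push_iter_lower (in_cone_linear C_linear CS)
  (in_cone_positive C_positive CS) e0 ex (ltW eps0) hS.
case: CS => [S0|[t [T [t0 CT ->]]]] lower.
  by have := lower 1; rewrite S0 /= normr0; lra.
apply: (@geometric_growth_not_quasinilpotent _ _ T x0 (`|e| - eps) t) => //.
- by rewrite subr_gt0.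
- move=> n; have := lower n; rewrite (iter_scale _ _ _ (C_linear _ CT)) normrZ.
  by rewrite gtr0_norm // exprn_gt0.
- exact: C_quasinilpotent.
Qed.
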